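(* Let $N\ge1$, $0<s<1$ (with $s<1/2$ if $N=1$) and $r=1-s$. Let $u\ge0$ be a weak energy solution of $u_t=\nabla\cdot(u\nabla(-\Delta)^{-s}u)$ in $\mathbb{R}^N\times(0,\infty)$ with initial data $u_0\ge0$. If the initial data are integrable, then $u(\cdot,t)\in L\log L$ for all $t>0$, and for all small $t$, $0<t\le t_0$, we have $$\int_{\mathbb{R}^N} u(t)\log(1+u(t))\,dx+\frac1t\int_0^t \tau\,\mathcal{B}_r\big(u(\tau)_1^+,u(\tau)_1^+\big)\,d\tau\le C_0\,|\log t|\,\|u_0\|_{L^1},$$ where $u(\tau)_1^+=(u(\cdot,\tau)-1)_+$ and $C_0$ depends only on $N$ and $s$. The time $t_0$ is estimated as $t_0=\inf\{1,\;C\|u_0\|_{L^1}^{-\vartheta}\}$ for some constants $C,\vartheta>0$.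
   Context: $u(\cdot,t)\in L\log L$ means $\int u(t)\log(1+u(t))\,dx<\infty$. The operator $\mathcal{L}=(-\Delta)^{-s}$ acts in the space variable as convolution with $L(x)=c(N,s)|x|^{-N+2s}$. For real functions $v,w$ put $$\mathcal{B}_r(v,w)=C_N\iint (v(x)-v(y))\frac{1}{|x-y|^{N+2r}}(w(x)-w(y))\,dx\,dy,$$ with $C_N>0$ normalized so that $\mathcal{B}_r(v,w)=\int\nabla v\cdot\nabla\mathcal{L}w\,dx$ for nice $v,w$. Weak solution in $Q_T=\mathbb{R}^N\times(0,T)$ with initial data $u_0\in L^1(\mathbb{R}^N)$: $u\in L^1(Q_T)$, $\mathcal{L}u\in L^1_{loc}(0,T;W^{1,1}_{loc}(\mathbb{R}^N))$, $u\nabla\mathcal{L}u\in L^1(Q_T)$, and $$\iint u\,(\eta_t-\nabla\mathcal{L}u\cdot\nabla\eta)\,dx\,dt+\int u_0(x)\eta(x,0)\,dx=0$$ for all $C^1$ test functions $\eta$ in $Q_T$ that are compactly supported in the space variable and vanish near $t=T$. Weak energy solution: a weak solution for which the integrations by parts behind the energy estimates are justified, i.e. the weak identity may also be used with bounded $\eta\in L^2(0,T;H^r(\mathbb{R}^N))$, $\eta_t\in L^2(Q_T)$ (the spatial term being interpreted through $\mathcal{B}_r$), and, for $f$ smooth and bounded, $F(\sigma)=\int^\sigma f$, and $0\le t_1<t_2\le T$, $$\int F(u(t))\,dx\Big|_{t_1}^{t_2}+\int_{t_1}^{t_2}\int\nabla[f(u)]\cdot u\nabla\mathcal{L}u\,dx\,dt=0,$$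 where $\int \nabla[f(u)]\cdot u\nabla\mathcal{L}u\,dx=\mathcal{B}_r(G(u),u)$ with $G'(\sigma)=\sigma f'(\sigma)$. The solutions considered are the constructed ones (limits of smooth functions satisfying these identities); they are bounded, conserve mass, $\int u(x,t)\,dx=\int u_0\,dx$, and $\int\Phi(u(t))\,dx$ is non-increasing in $t$ for convex $\Phi$.
   Formalization: As written, small mass gives t_0=1, where the right side C_0|log 1|‖u_0‖ is 0 but the left side is positive; so t_0=inf{κ, C‖u_0‖^{-ϑ}} is used for every κ in (0,1), with C, ϑ independent of κ and C_0 depending on N, s and κ. *)

(* Defs.v *)
From HB Require Import structures.
From mathcomp Require Import all_boot all_order all_algebra.
From mathcomp Require Import all_classical all_reals all_analysis.

Set Implicit Arguments.
Unset Strict Implicit.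
Unset Printing Implicit Defensive.

Import Order.TTheory GRing.Theory Num.Theory.
Import numFieldNormedType.Exports.

Local Open Scope classical_set_scope.
Local Open Scope ring_scope.

(* The library's sigma-finiteness instance of product measures is shadowed by
   the one of products of probability measures. *)
Lemma sigma_finite_product d1 d2 (T1 : measurableType d1)
    (T2 : measurableType d2) (R : realType)
    (m1 : {sigma_finite_measure set T1 -> \bar R})
    (m2 : {sigma_finite_measure set T2 -> \bar R}) :
  sigma_finite setT (m1 \x m2)%E.
Proof.
have /sigma_finiteP[F [TF ndF Foo]] := sigma_finiteT m1.
have /sigma_finiteP[G [TG ndG Goo]] := sigma_finiteT m2.
exists (fun n => F n `*` G n).
  rewrite -setXTT TF TG predeqE => -[x y]; split.
    move=> [/= [n _ Fnx] [k _ Gky]]; exists (maxn n k) => //; split.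
    - by move: x Fnx; exact/subsetPset/ndF/leq_maxl.
    - by move: y Gky; exact/subsetPset/ndG/leq_maxr.
  by move=> [n _ []/= ? ?]; split; exists n.
move=> k; have [? ?] := Foo k; have [? ?] := Goo k.
split; first exact: measurableX.
by rewrite product_measure1E// lte_mul_pinfty// ge0_fin_numE.
Qed.

(* R^N is 'rV[R]_N; the sigma-algebra generated by the coordinates is the
   Borel one.  Lebesgue measure on R^N is the iterated product measure. *)
Section lebesgue_rV.
Context {R : realType}.

Definition rV_display : measure_display.
Proof. exact: (measure_tuple_display default_measure_display). Qed.

Section measurable_rV.
Variable n : nat.

Let coord : 'I_n -> 'rV[R]_n -> R := fun i x => x ord0 i.

Let rV_set0 : g_sigma_preimage coord set0.
Proof. exact: sigma_algebra0. Qed.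

Let rV_setC A : g_sigma_preimage coord A -> g_sigma_preimage coord (~` A).
Proof. exact: sigma_algebraC. Qed.

Let rV_bigcup (F : (set 'rV[R]_n)^nat) :
  (forall i, g_sigma_preimage coord (F i)) ->
  g_sigma_preimage coord (\bigcup_i (F i)).
Proof. exact: sigma_algebra_bigcup. Qed.

HB.instance Definition _ := @isMeasurable.Build rV_display
  'rV[R]_n (g_sigma_preimage coord) rV_set0 rV_setC rV_bigcup.

Lemma measurable_coord (i : 'I_n) :
  measurable_fun [set: 'rV[R]_n] (fun x : 'rV[R]_n => x ord0 i).
Proof.
move=> _ Y mY; rewrite setTI; apply: sub_sigma_algebra => /=.
rewrite -bigcup_seq/=; exists i => /=; first by rewrite mem_index_enum.
by exists Y => //; rewrite setTI.
Qed.

Lemma measurable_fun_coordP d (T : measurableType d) (f : T -> 'rV[R]_n) :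
  (forall i, measurable_fun [set: T] (fun x => f x ord0 i)) ->
  measurable_fun [set: T] f.
Proof.
move=> mf.
suff prefS : g_sigma_preimage (fun i => coord i \o f) `<=` measurable.
  move=> _ A mA; apply: prefS.
  by rewrite g_sigma_preimage_comp; exists A.
apply: smallest_sub; first exact: sigma_algebra_measurable.
rewrite -bigcup_seq; apply: bigcup_sub => i _.
by move=> A [B mB <-]; exact: mf.
Qed.

End measurable_rV.

Definition rV_cons n (p : R * 'rV[R]_n) : 'rV[R]_n.+1 :=
  \row_i if unlift ord0 i is Some j then p.2 ord0 j else p.1.

Definition rV_uncons n (x : 'rV[R]_n.+1) : R * 'rV[R]_n :=
  (x ord0 ord0, \row_j x ord0 (lift ord0 j)).

Lemma rV_consK n : cancel (@rV_cons n) (@rV_uncons n).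
Proof.
move=> [a x]; rewrite /rV_uncons; congr (_, _).
  by rewrite mxE unlift_none.
by apply/rowP => j; rewrite !mxE liftK.
Qed.

Lemma rV_unconsK n : cancel (@rV_uncons n) (@rV_cons n).
Proof.
move=> x; apply/rowP => j; rewrite mxE.
by case: (unliftP ord0 j) => [k|] -> //=; rewrite mxE.
Qed.

Lemma measurable_rV_cons n :
  measurable_fun [set: measurableTypeR R * 'rV[R]_n] (@rV_cons n).
Proof.
apply: measurable_fun_coordP => i; case: (unliftP ord0 i) => [k|] ->.
  rewrite (_ : (fun x => _) = (fun y : 'rV[R]_n => y ord0 k) \o snd).
    by apply: measurableT_comp; [exact: measurable_coord|exact: measurable_snd].
  by apply/funext => -[a y]/=; rewrite mxE liftK.
rewrite (_ : (fun x => _) = fst); first exact: measurable_fst.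
by apply/funext => -[a y]/=; rewrite mxE unlift_none.
Qed.

Lemma measurable_rV_uncons n :
  measurable_fun [set: 'rV[R]_n.+1]
    (@rV_uncons n : _ -> measurableTypeR R * 'rV[R]_n).
Proof.
apply/measurable_fun_pairP; split; first exact: measurable_coord.
apply: measurable_fun_coordP => i.
rewrite (_ : (fun x => _) = fun x : 'rV[R]_n.+1 => x ord0 (lift ord0 i)).
  exact: measurable_coord.
by apply/funext => x /=; rewrite mxE.
Qed.

Section step.
Variables (n : nat) (mu : {sigma_finite_measure set 'rV[R]_n -> \bar R}).

Definition measure_rV_cons : set 'rV[R]_n.+1 -> \bar R :=
  pushforward (@lebesgue_measure R \x mu)%E (@rV_cons n).

Let rV_cons_preimage A : measurable A ->
  measurable (@rV_cons n @^-1` A : set (measurableTypeR R * 'rV[R]_n)).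
Proof.
by move=> mA; rewrite -[X in measurable X]setTI; exact: measurable_rV_cons.
Qed.

Let measure_rV_cons0 : measure_rV_cons set0 = 0%E.
Proof. by rewrite /measure_rV_cons /pushforward preimage_set0 measure0. Qed.

Let measure_rV_cons_ge0 A : (0 <= measure_rV_cons A)%E.
Proof. by rewrite /measure_rV_cons /pushforward; apply: measure_ge0. Qed.

Let measure_rV_cons_sigma_additive : semi_sigma_additive measure_rV_cons.
Proof.
move=> F mF tF mUF; rewrite /measure_rV_cons /pushforward preimage_bigcup.
apply: measure_semi_sigma_additive.
- by move=> k; exact: rV_cons_preimage.
- apply/trivIsetP => /= i j _ _ ij; rewrite -preimage_setI.
  by move/trivIsetP : tF => /(_ _ _ _ _ ij) ->//; rewrite preimage_set0.
- by rewrite -preimage_bigcup; exact: rV_cons_preimage.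
Qed.

HB.instance Definition _ := isMeasure.Build _ _ _ measure_rV_cons
  measure_rV_cons0 measure_rV_cons_ge0 measure_rV_cons_sigma_additive.

Let sigma_finite_measure_rV_cons : sigma_finite setT measure_rV_cons.
Proof.
have [F TF Foo] := sigma_finite_product (@lebesgue_measure R) mu.
exists (fun k => @rV_uncons n @^-1` F k).
  by rewrite -preimage_bigcup -TF preimage_setT.
move=> k; have [mF Fk] := Foo k; split.
  by rewrite -[X in measurable X]setTI; exact: measurable_rV_uncons.
rewrite /measure_rV_cons /pushforward -comp_preimage.
by rewrite (_ : _ \o _ = id)//; apply/funext => p /=; exact: rV_consK.
Qed.

HB.instance Definition _ := Measure_isSigmaFinite.Build _ _ _
  measure_rV_cons sigma_finite_measure_rV_cons.

End step.

Fixpoint lebesgue_rV n : {sigma_finite_measure set 'rV[R]_n -> \bar R} :=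
  match n with
  | 0 => (\d_(0 : 'rV[R]_0))%R
  | m.+1 => measure_rV_cons (lebesgue_rV m)
  end.

End lebesgue_rV.

Section fractional_porous_medium.
Context {R : realType} {N : nat}.
Implicit Types (s r t T : R) (x y : 'rV[R]_N) (v w : 'rV[R]_N -> R)
  (u eta g h : R -> 'rV[R]_N -> R).

Local Notation leb := (@lebesgue_measure R).
Local Notation mu := (@lebesgue_rV R N).
Local Notation e_ i := (@delta_mx R 1 N ord0 i).

(* The norm of 'rV[R]_N in the library is the sup norm. *)
Definition enorm x : R := Num.sqrt (\sum_i x ord0 i ^+ 2).

Definition Gamma (z : R) : R :=
  \int[leb]_(t in `]0, +oo[) (t `^ (z - 1) * expR (- t)).

(* L(x) = c(N,s) |x|^(-N+2s) is the kernel of (-Delta)^(-s), whose Fourier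
   symbol is |xi|^(-2s). *)
Definition riesz_const s : R :=
  Gamma (N%:R / 2 - s) / (4 `^ s * pi `^ (N%:R / 2) * Gamma s).

Definition riesz_kernel s x : R := riesz_const s * enorm x `^ (2 * s - N%:R).

Definition riesz_potential s v x : R :=
  \int[mu]_y (riesz_kernel s (x - y) * v y).

(* The constant for which energy_form r v w = \int grad v . grad (L * w), where
   r = 1 - s: away from 0, Delta L = c(N,s) (N - 2s) (2 - 2s) |x|^(-N-2r), so
   that
   - \int v Delta (L * w) dx =
     \iint v(x) Delta L(x - y) (w(x) - w(y)) dx dy,
   and symmetrizing in x, y halves the constant. *)
Definition energy_form_const r : R :=
  riesz_const (1 - r) * (N%:R - 2 * (1 - r)) * r.

Definition energy_form_density r v w (p : 'rV[R]_N * 'rV[R]_N) : R :=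
  (v p.1 - v p.2) * (w p.1 - w p.2) / enorm (p.1 - p.2) `^ (N%:R + 2 * r).

Definition energy_form r v w : \bar R :=
  ((energy_form_const r)%:E *
     \int[mu \x mu]_p (energy_form_density r v w p)%:E)%E.

Definition C1 v : Prop :=
  forall i, (forall x, derivable v x (e_ i)) /\ continuous ('D_(e_ i) v).

Definition C1_txn eta : Prop :=
  [/\ forall t x, derivable (eta ^~ x) t 1,
      continuous (fun p : R * 'rV[R]_N => derive1 (eta ^~ p.2) p.1),
      forall t i x, derivable (eta t) x (e_ i) &
      forall i, continuous (fun p : R * 'rV[R]_N => 'D_(e_ i) (eta p.1) p.2)].

Definition compactly_supported v : Prop :=
  exists rho : R, forall x, rho <= enorm x -> v x = 0.

Definition weak_gradient v (g : 'I_N -> 'rV[R]_N -> R) : Prop :=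
  forall phi i, C1 phi -> compactly_supported phi ->
    \int[mu]_x (v x * 'D_(e_ i) phi x) = - \int[mu]_x (g i x * phi x).

Definition integrable_txn (I : set R) (D : set 'rV[R]_N) u : Prop :=
  (leb \x mu)%E.-integrable (I `*` D) (fun p => (u p.1 p.2)%:E).

(* u in L^1_loc(0,T; W^{1,1}_loc(R^N)), with spatial gradient g *)
Definition L1loc_W11loc T u (g : 'I_N -> R -> 'rV[R]_N -> R) : Prop :=
  (forall a b rho : R, 0 < a -> b < T ->
     let D := [set x | enorm x <= rho] in
     integrable_txn `[a, b] D u /\ forall i, integrable_txn `[a, b] D (g i)) /\
  {ae leb, forall t, 0 < t < T -> weak_gradient (u t) (fun i => g i t)}.

Definition test_function T eta : Prop :=
  [/\ C1_txn eta,
      exists rho : R, forall t x, rho <= enorm x -> eta t x = 0 &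
      exists2 delta : R, 0 < delta < T &
        forall t x, T - delta <= t -> eta t x = 0].

Definition weak_solution s T u (u0 : 'rV[R]_N -> R) : Prop :=
  integrable_txn `]0, T[ setT u /\
  exists g : 'I_N -> R -> 'rV[R]_N -> R,
    [/\ L1loc_W11loc T (fun t => riesz_potential s (u t)) g,
        forall i, integrable_txn `]0, T[ setT (fun t x => u t x * g i t x) &
        forall eta, test_function T eta ->
          \int[(leb \x mu)%E]_(p in `]0, T[ `*` setT)
             (u p.1 p.2 * (derive1 (eta ^~ p.2) p.1
                - \sum_i g i p.1 p.2 * 'D_(e_ i) (eta p.1) p.2))
          + \int[mu]_x (u0 x * eta 0 x) = 0].

(* Bounded eta in L^2(0,T; H^r) with eta_t = h in L^2(Q_T), vanishing near
   t = T. *)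
Definition energy_test_function r T eta h : Prop :=
  let Q := `]0, T[ `*` setT in
  [/\ exists K : R, forall t x, 0 <= t <= T -> `|eta t x| <= K,
      measurable_fun (Q : set (measurableTypeR R * 'rV[R]_N))
        (fun p => eta p.1 p.2) /\
      (\int[leb]_(t in `]0%R, T[)
         (\int[mu]_x (eta t x ^+ 2)%:E
          + energy_form r (eta t) (eta t)) < +oo)%E,
      measurable_fun (Q : set (measurableTypeR R * 'rV[R]_N))
        (fun p => h p.1 p.2) /\
      (\int[(leb \x mu)%E]_(p in Q) (h p.1 p.2 ^+ 2)%:E < +oo)%E,
      forall t, 0 <= t <= T -> {ae mu, forall x,
        eta t x = eta 0 x + \int[leb]_(tau in `[0, t]) h tau x} &
      exists2 delta : R, 0 < delta < T &
        forall t x, T - delta <= t <= T -> eta t x = 0].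

(* \int_0^sigma z f'(z) dz *)
Definition weighted_primitive (f : R -> R) (sigma : R) : R :=
  \int[leb]_(z in `[0, sigma]) (z * derive1 f z).

(* The spatial term \int u grad eta . grad Lu equals energy_form r v u as soon
   as u grad eta = grad v, that is, du /\ d eta = 0: eta = phi(t, u) and
   v = \int_0^u z phi_z(t, z) dz. *)
Definition extended_weak_identity r T u (u0 : 'rV[R]_N -> R) : Prop :=
  forall (phi : R -> R -> R) h,
    measurable_fun [set: measurableTypeR R * measurableTypeR R]
      (fun p => phi p.1 p.2) ->
    (forall t z, derivable (phi t) z 1) ->
    (forall t, continuous (derive1 (phi t))) ->
    let eta t x := phi t (u t x) in
    let v t x := weighted_primitive (phi t) (u t x) in
    energy_test_function r T eta h ->
    integrable_txn `]0, T[ setT (fun t x => u t x * h t x) ->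
    (\int[leb]_(t in `]0%R, T[)
       \int[mu \x mu]_p `|energy_form_density r (v t) (u t) p|%:E < +oo)%E ->
    (\int[leb \x mu]_(p in `]0%R, T[ `*` setT) (u p.1 p.2 * h p.1 p.2)%:E
     - \int[leb]_(t in `]0%R, T[) energy_form r (v t) (u t)
     + \int[mu]_x (u0 x * phi 0 (u0 x))%:E = 0)%E.

Definition smooth (f : R -> R) : Prop :=
  forall n z, derivable (derive1n n f) z 1.

Definition energy_identity r T u : Prop :=
  forall f : R -> R, smooth f -> (exists K : R, forall z, `|f z| <= K) ->
    let F z := \int[leb]_(y in `[0, z]) f y in
    let G := weighted_primitive f in
    forall t1 t2, 0 <= t1 -> t1 < t2 -> t2 <= T ->
      (\int[mu]_x (F (u t2 x))%:E - \int[mu]_x (F (u t1 x))%:E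
       + \int[leb]_(t in `]t1, t2[) energy_form r (G \o u t) (u t) = 0)%E.

Definition weak_energy_solution s T u (u0 : 'rV[R]_N -> R) : Prop :=
  [/\ weak_solution s T u u0,
      extended_weak_identity (1 - s) T u u0 &
      energy_identity (1 - s) T u].

(* Merely integrable initial data need not be bounded, hence boundedness is
   only required for positive times.  For convex Phi : R -> R with Phi(0) = 0
   but Phi not nonnegative, subtract a supporting line at 0 and use
   conservation of mass. *)
Record constructed_solution u (u0 : 'rV[R]_N -> R) : Prop := {
  measurable_solution :
    measurable_fun (`[0, +oo[ `*` setT : set (measurableTypeR R * 'rV[R]_N))
      (fun p => u p.1 p.2) ;
  initial_solution : {ae mu, forall x, u 0 x = u0 x} ;
  bounded_solution : forall tau : R, 0 < tau ->
    exists K : R, forall t x, tau <= t -> u t x <= K ;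
  mass_solution : forall t, 0 <= t ->
    (\int[mu]_x (u t x)%:E = \int[mu]_x (u0 x)%:E)%E ;
  convex_solution : forall Phi : R^o -> R^o,
    convex_function [set z : R^o | 0 <= z] Phi ->
    (forall z, 0 <= z -> 0 <= Phi z) -> Phi 0 = 0 ->
    forall t1 t2, 0 <= t1 -> t1 <= t2 ->
      (\int[mu]_x (Phi (u t2 x))%:E <= \int[mu]_x (Phi (u t1 x))%:E)%E }.

Definition LlogL_integral v : \bar R := \int[mu]_x (v x * ln (1 + v x))%:E.

Definition LlogL v : Prop := (LlogL_integral v < +oo)%E.

Definition L1norm v : R := \int[mu]_x `|v x|.

Definition trunc_above1 v x : R := Num.max (v x - 1) 0.

(* inf {kappa, C m^(-theta)} with 0^(-theta) = +oo (the library has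
   0 `^ (- theta) = 0).  With kappa = 1 and a small mass m, t = 1 would be
   admissible, where |log t| = 0 although the mass is positive; hence the use
   with arbitrary kappa < 1. *)
Definition time_bound (kappa C theta m : R) : R :=
  if m == 0 then kappa else Num.min kappa (C * m `^ (- theta)).

End fractional_porous_medium.

Arguments riesz_const {R} N s.
Arguments energy_form_const {R} N r.

(* Main.v *)
Require Import Defs.
From mathcomp Require Import all_boot all_order all_algebra.
From mathcomp Require Import all_classical all_reals all_analysis.
From mathcomp Require Import measurable_realfun exponential_distribution.
From mathcomp Require Import ring lra.

Set Implicit Arguments.
Unset Strict Implicit.
Unset Printing Implicit Defensive.

Import Order.TTheory GRing.Theory Num.Theory.
Import numFieldNormedType.Exports.

Local Open Scope classical_set_scope.
Local Open Scope ring_scope.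

(** The energy identity is used with an entropy that behaves like z log z.  Take
    f(z) = log((1 + z^2) / (1 + e z^2)), 0 < e < 1, so that its primitive F
    lies between z log(1 + z) - z log 4 (for z <= K, if e K^2 <= 1) and
    2 z log(1 + z), and z f'(z) >= 1/2 on [1, K] (if e K^2 <= 1/3); the cut-off
    parameter e only serves to make f bounded, and since the solution is
    bounded for positive times no estimate depends on it.  With
    G' = z f'(z), the dissipation E(tau) = B_r(G(u), u) dominates half of
    B(tau) = B_r(w, w), w = (u - 1)_+, and phi(tau) = \int F(u(tau)) satisfies
    phi(tau) = phi(t) + \int_tau^t E.

    Conversely L log L is controlled by mass and energy
    ([LlogL_interpolation]): at a point x where w(x) exceeds four times the
    largest possible mean M l^(-N) of w over a cube of side l, most of the
    square of w(x) is visible in the differences w(x) - w(y), y in the cube,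
    hence in the energy density; elsewhere the logarithm is at most
    log(3 + 4 M l^(-N)).  Thus
      \int v log(1 + v) <= M log(3 + 4 M l^(-N)) + C l^(2r) B_r(w, w),
    an elementary substitute for a logarithmic Sobolev inequality.

    Integrating phi(tau) = phi(t) + \int_tau^t E over tau in (d, t) gives, by
    Tonelli,
      (t - d) phi(t) + \int_d^t (tau - d) E = \int_d^t phi,
    and the interpolation at scale l^(2r) ~ tau - d bounds the integrand on the
    right by C M (1 + |log (tau - d)|) + (tau - d) B / 4, whose last term is
    absorbed on the left ([time_weighted_energy]).  The smallness condition
    M t <= 1 turns log(3 + 4 M l^(-N)) into a multiple of 1 + |log (tau - d)|, so
    C = theta = 1 is a possible choice in the bound for t_0.  Finally d tends to
    0 ([solution_smoothing]), and 1 <= |log t| / |log kappa|.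

    The energy form has a positive constant in front because the Gamma integral
    is finite and positive on (0, +oo) ([Gamma_gt0]). *)

(** * The Gamma function and the constant of the energy form *)

Section gamma_function.
Context {R : realType}.
Local Notation leb := (@lebesgue_measure R).

(** For p < 1 the integrand is singular at a, so the fundamental theorem of
    calculus is applied on [a + h / n, a + h] and n tends to infinity. *)
Lemma integral_powR_le (a h p : R) : 0 < h -> 0 < p ->
  (\int[leb]_(t in `]a, (a + h)%R]) ((t - a) `^ (p - 1))%:E <= (h `^ p / p)%:E)%E.
Proof.
move=> h0 p0.
pose F n : set R := [set` `[a + h / n.+1%:R, a + h]].
have UF : [set` `]a, a + h]] = \bigcup_n F n.
  apply/seteqP; split => [x /=|x [n _]]; rewrite /F /= !in_itv/=.
    move=> /andP[ax xh]; have x0 : 0 < x - a by rewrite subr_gt0.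
    exists (Num.truncn (h / (x - a))) => //=; rewrite in_itv/= xh andbT.
    rewrite -lerBrDl ler_pdivrMr// mulrC -ler_pdivrMr// ltW//.
    exact: truncnS_gt.
  move=> /andP[hx ->]; rewrite andbT; apply: lt_le_trans hx.
  by rewrite ltrDl divr_gt0.
have mf (A : set R) : measurable_fun A (EFin \o (fun t : R => (t - a) `^ (p - 1))).
  apply: measurable_funTS; apply/measurable_EFinP.
  apply: (measurableT_comp (measurable_powR _)).
  by apply: measurable_funB => //; exact: measurable_cst.
have cv : (\int[leb]_(t in F n) ((t - a) `^ (p - 1))%:E @[n --> \oo] -->
    \int[leb]_(t in \bigcup_n F n) ((t - a) `^ (p - 1))%:E)%E.
  apply: ge0_nondecreasing_set_cvg_integral.
  - apply/nondecreasing_seqP => n; rewrite subsetEset => x; rewrite /F /= !in_itv/=.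
    move=> /andP[hx ->]; rewrite andbT; apply: le_trans hx.
    by rewrite lerD2l ler_pM2l// lef_pV2 ?posrE// ler_nat.
  - by move=> n; exact: measurable_itv.
  - by move=> n; exact: mf.
  - by move=> n x _; rewrite lee_fin powR_ge0.
rewrite UF -(cvg_lim _ cv)//.
apply: lime_le; first by apply/cvg_ex; eexists; exact: cv.
apply: nearW => -[|n].
  by rewrite /F divr1 set_itv1 integral_set1 lee_fin divr_ge0 ?powR_ge0// ltW.
have hn0 : 0 < h / n.+2%:R by exact: divr_gt0.
have hn : a + h / n.+2%:R < a + h.
  by rewrite ltrD2l ltr_pdivrMr// ltr_pMr// ltr1n.
have ds (x : R) : is_derive x (1 : R) (fun t : R => t - a : R^o) (1 : R^o).
  rewrite -[X in is_derive _ _ _ X]subr0.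
  exact: is_deriveB (is_derive_id _ _) (is_derive_cst _ _ _).
have dpow (q x : R) : a < x ->
    is_derive x (1 : R) (fun t : R => (t - a) `^ q : R^o) (q * (x - a) `^ (q - 1)).
  rewrite -subr_gt0 => x0; rewrite -[X in is_derive _ _ _ X]mulr1.
  exact: (is_derive1_comp (g := fun t : R => t - a) (is_derive1_powR q x0) (ds x)).
have dF (x : R) : a < x ->
    is_derive x 1 (fun t => (t - a) `^ p / p) ((x - a) `^ (p - 1)).
  move=> x0; rewrite (_ : (fun t => _) = p^-1 \*: (fun t : R => (t - a) `^ p : R^o)).
    have := is_deriveZ p^-1 (dpow p x x0).
    by rewrite /GRing.scale/= mulrA mulVf ?mul1r ?gt_eqF.
  by apply/funext => t; rewrite /GRing.scale/= mulrC.
have cF (x : R) : a < x -> {for x, continuous (fun t => (t - a) `^ p / p)}.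
  by move=> x0; apply/differentiable_continuous/derivable1_diffP; have [] := dF x x0.
have cf (x : R) : a < x -> {for x, continuous (fun t : R => (t - a) `^ (p - 1))}.
  by move=> x0; apply/differentiable_continuous/derivable1_diffP;
     have [] := dpow (p - 1) x x0.
have ahn : a < a + h / n.+2%:R by rewrite ltrDl.
rewrite /F (@continuous_FTC2 _ _ (fun t => (t - a) `^ p / p))//.
- rewrite -EFinB lee_fin (addrC a h) addrK lerBlDr lerDl divr_ge0 ?powR_ge0//.
  exact: ltW.
- apply: continuous_in_subspaceT => x; rewrite inE/= in_itv/= => /andP[hx _].
  by apply: cf; exact: lt_le_trans hx.
- split.
  + move=> x; rewrite in_itv/= => /andP[hx _].
    by have [] := dF x (lt_trans ahn hx).
  + by apply: cvg_at_right_filter; exact: cF.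
  + by apply: cvg_at_left_filter; apply: cF; rewrite ltrDl.
- move=> x; rewrite in_itv/= => /andP[hx _].
  by rewrite derive1E; have [_ ->] := dF x (lt_trans ahn hx).
Qed.

Lemma expR_ge_pow (n : nat) (t : R) : 0 <= t ->
  t ^+ n.+1 <= n.+1`!%:R * expR t.
Proof.
move=> t0; rewrite -ler_pdivrMl ?ltr0n ?fact_gt0// mulrC.
by apply: le_trans (expR_ge1Dxn n t0); rewrite lerDr.
Qed.

(** The integrand is dominated by t^(z-1) on ]0, 1] and, from t = 1 on, by a
    multiple of the exponential density of rate 1/2. *)
Lemma Gamma_integrable (z : R) : 0 < z ->
  leb.-integrable `]0, +oo[ (EFin \o (fun t => t `^ (z - 1) * expR (- t))).
Proof.
move=> z0.
have mG (A : set R) :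
    measurable_fun A (EFin \o (fun t : R => t `^ (z - 1) * expR (- t))).
  apply: measurable_funTS; apply/measurable_EFinP; apply: measurable_funM.
    exact: measurable_powR.
  by apply: measurableT_comp => //; exact: measurable_expR.
apply/integrableP; split; first exact: mG.
pose n := Num.truncn z.
pose C : R := (2 ^+ n.+1) * n.+1`!%:R * 2.
have C0 : 0 <= C by rewrite /C !mulr_ge0// exprn_ge0.
pose g (t : R) : \bar R := (((fun x : R => x `^ (z - 1)) \_ `]0%R, 1%R]) t)%:E.
pose e (t : R) := exponential_pdf (2^-1 : R) t.
have mg : measurable_fun [set: R] g.
  apply/measurable_EFinP; apply/(measurable_restrictT _ _).1 => //.
  by apply: measurable_funTS; exact: measurable_powR.
have g0 t : (0 <= g t)%E.
  by rewrite /g lee_fin; apply: restrict_ge0 => x _; exact: powR_ge0.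
have e0 t : 0 <= e t by rewrite /e exponential_pdf_ge0.
have me : measurable_fun [set: R] e by exact: measurable_exponential_pdf.
apply: (@le_lt_trans _ _ (\int[leb]_x (g x + (C * e x)%:E))%E).
  rewrite [leLHS]integral_mkcond; apply: ge0_le_integral => //.
  - by move=> x _; apply: erestrict_ge0 => y _; exact: abse_ge0.
  - by apply/(measurable_restrictT _ _).1 => //; apply: measurableT_comp => //; exact: mG.
  - by apply: emeasurable_funD => //; apply/measurable_EFinP; exact: measurable_funM.
  move=> x _; rewrite patchE; case: ifPn => [|_]; last first.
    by rewrite adde_ge0// lee_fin mulr_ge0.
  rewrite inE/= in_itv/= andbT => x0.
  rewrite ger0_norm ?mulr_ge0 ?powR_ge0 ?expR_ge0// /g patchE; case: ifPn => x1.
    rewrite -EFinD lee_fin -[leLHS]addr0 lerD ?mulr_ge0//.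
    by rewrite ler_piMr ?powR_ge0// expR_le1 oppr_le0 ltW.
  have {}x1 : 1 < x.
    rewrite ltNge; apply: contra x1 => x1.
    by rewrite inE/= in_itv/= x0.
  rewrite add0e lee_fin /e exponential_pdfE ?(ltW x0)//.
  have -> : - x = - 2^-1 * x + - 2^-1 * x by lra.
  rewrite expRD mulrA (mulrA C); apply: ler_wpM2r; first exact: expR_ge0.
  have -> : C * 2^-1 = 2 ^+ n.+1 * n.+1`!%:R by rewrite /C mulfK// pnatr_eq0.
  rewrite mulNr expRN -ler_pdivlMr ?invr_gt0 ?expR_gt0// invrK.
  apply: (@le_trans _ _ (x ^+ n.+1)).
    rewrite -powR_mulrn ?(ltW x0)//; apply: ler_powR; first exact: ltW.
    have zn := truncnS_gt z.
    by rewrite lerBlDr (le_trans (ltW zn))// lerDl.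
  have {1}-> : x = 2 * (2^-1 * x) by rewrite mulrA mulfV ?mul1r// pnatr_eq0.
  rewrite -mulrA exprMn ler_wpM2l ?exprn_ge0//.
  by apply: expR_ge_pow; rewrite mulr_ge0// ltW.
rewrite ge0_integralD//=; last 2 first.
- by move=> x _; rewrite lee_fin mulr_ge0.
- by apply/measurable_EFinP; exact: measurable_funM.
apply: lte_add_pinfty.
  rewrite (_ : (\int[leb]_x g x)%E =
      (\int[leb]_(x in `]0%R, 1%R]) (x `^ (z - 1))%:E)%E); last first.
    by rewrite [RHS]integral_mkcond restrict_EFin.
  have := @integral_powR_le 0 1 z ltr01 z0; rewrite add0r.
  under eq_integral do rewrite subr0.
  by move/le_lt_trans; apply; rewrite ltry.
under eq_integral do rewrite EFinM.
rewrite ge0_integralZl_EFin//.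
- by rewrite integral_exponential_pdf// mule1 ltry.
- by move=> x _; rewrite lee_fin.
- exact/measurable_EFinP.
Qed.

Lemma Gamma_gt0 (z : R) : 0 < z -> 0 < Gamma z.
Proof.
move=> z0; have iG := Gamma_integrable z0.
have sub12 : (`[1, 2]%classic : set R) `<=` `]0, +oo[.
  by move=> x /=; rewrite !in_itv/= andbT => /andP[x1 _]; exact: lt_le_trans x1.
pose c : R := expR (- `|z - 1| * 2 - 2).
(* |ln t| <= 2 on [1, 2], hence the integrand is at least c there. *)
have i12 : leb.-integrable `[1, 2] (EFin \o (fun t => t `^ (z - 1) * expR (- t))).
  exact: integrableS iG.
apply: (@lt_le_trans _ _ (\int[leb]_(t in `[1, 2]) c)).
  rewrite Rintegral_cst//= lebesgue_measure_itv/= lte_fin ltr1n/=.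
  by rewrite mulr_gt0 ?expR_gt0// subr_gt0 ltr1n.
apply: (@le_trans _ _ (\int[leb]_(t in `[1, 2]) (t `^ (z - 1) * expR (- t)))).
  apply: le_Rintegral => //.
    apply/integrableP; split; first exact: measurable_cst.
    rewrite integral_cst//= lebesgue_measure_itv/= lte_fin ltr1n/=.
    by rewrite -EFinD -EFinM ltry.
  move=> t /=; rewrite in_itv/= => /andP[t1 t2].
  have t0 : 0 < t by lra.
  rewrite /powR gt_eqF// -expRD ler_expR.
  have l0 : 0 <= ln t by exact: ln_ge0.
  have lt : ln t <= 2 by apply: le_trans t2; exact/ltW/ln_sublinear.
  have zn : - `|z - 1| <= z - 1 by rewrite lerNl -normrN ler_norm.
  have := normr_ge0 (z - 1).
  nra.
rewrite /Gamma /Rintegral fine_le//.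
- exact: integrable_fin_num.
- exact: integrable_fin_num.
- apply: ge0_subset_integral => //.
  + exact: measurable_int iG.
  + by move=> x _; rewrite lee_fin mulr_ge0 ?powR_ge0 ?expR_ge0.
Qed.

(** N > 2 s is where the restriction s < 1/2 in dimension 1 enters. *)
Lemma energy_form_const_gt0 (N : nat) (s : R) : (1 <= N)%N -> 0 < s < 1 ->
  (N = 1%N -> s < 1 / 2) -> 0 < energy_form_const N (1 - s).
Proof.
move=> hN /andP[s0 s1] hs1.
have Ns : 0 < N%:R - 2 * s.
  move: N hN hs1 => [//|[|N]] _ hs1.
    by have := hs1 erefl; lra.
  have : 2 <= N.+2%:R :> R by rewrite ler_nat.
  lra.
have G1 : 0 < Gamma (N%:R / 2 - s) by apply: Gamma_gt0; lra.
have G2 : 0 < Gamma s by exact: Gamma_gt0.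
rewrite /energy_form_const subKr; apply: mulr_gt0; last by lra.
apply: mulr_gt0 => //; apply: divr_gt0 => //.
by rewrite !mulr_gt0 ?powR_gt0 ?pi_gt0.
Qed.

End gamma_function.

(** * Cubes in R^N *)

Section boxes.
Context {R : realType}.
Local Notation leb := (@lebesgue_measure R).

Definition box N (x : 'rV[R]_N) (l : R) : set 'rV[R]_N :=
  [set y | forall i, x ord0 i <= y ord0 i <= x ord0 i + l].

Lemma measurable_box N (x : 'rV[R]_N) (l : R) : measurable (box x l).
Proof.
rewrite (_ : box x l = \bigcap_(i in [set: 'I_N])
    ((fun y : 'rV[R]_N => y ord0 i) @^-1` `[x ord0 i, x ord0 i + l])).
  apply: fin_bigcap_measurable => [|i _]; first exact: finite_finset.
  rewrite -[X in measurable X]setTI; exact: measurable_coord.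
by apply/seteqP; split => [y yb i _|y yb i]; have := yb i; rewrite /= ?in_itv//=; apply.
Qed.

Lemma lebesgue_box N (x : 'rV[R]_N) (l : R) : 0 <= l ->
  lebesgue_rV N (box x l) = (l ^+ N)%:E.
Proof.
move=> l0; elim: N x => [|n IH] x.
  rewrite expr0 /= diracE mem_set//.
  by case.
rewrite [LHS](_ : _ = (leb \x lebesgue_rV n)%E
    (`[x ord0 ord0, x ord0 ord0 + l] `*` box (\row_j x ord0 (lift ord0 j)) l)).
  rewrite product_measure1E//=; last exact: measurable_box.
  rewrite IH lebesgue_measure_itv/= lte_fin ltrDl exprS EFinM.
  move: l0; rewrite le_eqVlt => /predU1P[<-|l0]; first by rewrite ltxx !mul0e.
  by rewrite l0 -EFinB (addrC _ l) addrK.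
rewrite /= /measure_rV_cons /pushforward; congr (_ _); apply/seteqP; split => -[a y] /=.
  move=> yb; split => /=.
    by have := yb ord0; rewrite mxE unlift_none/= in_itv.
  by move=> i; have := yb (lift ord0 i); rewrite !mxE liftK.
rewrite in_itv/= => -[ab yb] i; rewrite mxE.
case: (unliftP ord0 i) => [j|] -> //.
by have := yb j; rewrite mxE.
Qed.

End boxes.

(** * The density of the energy form *)

Section energy_density.
Context {R : realType} {N : nat}.
Local Notation mu := (@lebesgue_rV R N).
Local Notation rV := 'rV[R]_N.
Implicit Types (x y : rV) (v w : rV -> R).

Lemma enorm_ge0 x : 0 <= enorm x. Proof. exact: sqrtr_ge0. Qed.

Lemma enorm_eq0 x : enorm x = 0 -> x = 0.
Proof.
move=> /eqP; rewrite sqrtr_eq0 => s0.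
apply/rowP => i; rewrite mxE; apply/eqP; rewrite -sqrf_eq0; apply/eqP.
have [/psumr_eq0P] : (forall i, true -> 0 <= x ord0 i ^+ 2) /\ \sum_i x ord0 i ^+ 2 = 0.
  split; first by move=> j _; exact: sqr_ge0.
  by apply/eqP; rewrite eq_le s0 sumr_ge0// => j _; exact: sqr_ge0.
by move=> H /H; apply.
Qed.

Lemma measurable_enorm : measurable_fun [set: rV] (@enorm R N).
Proof.
apply: (measurableT_comp (continuous_measurable_fun (@sqrt_continuous R))).
apply: measurable_sum => i; apply: measurable_funX; exact: measurable_coord.
Qed.

Lemma measurable_rV_sub d (T : measurableType d) (f g : T -> rV) :
  measurable_fun setT f -> measurable_fun setT g ->
  measurable_fun setT (fun t => f t - g t).
Proof.
move=> mf mg; apply: measurable_fun_coordP => i.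
rewrite (_ : (fun _ => _) = (fun t => f t ord0 i - g t ord0 i)); last first.
  by apply/funext => t; rewrite !mxE.
apply: measurable_funB.
- exact: (measurableT_comp (measurable_coord i)).
- exact: (measurableT_comp (measurable_coord i)).
Qed.

(** The functions depend on a parameter t in T, as measurability in time of the
    energy is needed later. *)
Lemma measurable_energy_form_density d (T : measurableType d) (r : R)
    (V W : T -> rV -> R) :
  measurable_fun setT (fun p : T * rV => V p.1 p.2) ->
  measurable_fun setT (fun p : T * rV => W p.1 p.2) ->
  measurable_fun setT (fun p : (T * rV) * rV =>
    energy_form_density r (V p.1.1) (W p.1.1) (p.1.2, p.2)).
Proof.
move=> mV mW; rewrite /energy_form_density /=.
have m1 : measurable_fun setT (fun p : (T * rV) * rV => p.1.1).
  by apply: (measurableT_comp measurable_fst); exact: measurable_fst.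
have m2 : measurable_fun setT (fun p : (T * rV) * rV => p.1.2).
  by apply: (measurableT_comp measurable_snd); exact: measurable_fst.
have m3 : measurable_fun setT (fun p : (T * rV) * rV => p.2) by exact: measurable_snd.
have mpair (U : T -> rV -> R) : measurable_fun setT (fun p : T * rV => U p.1 p.2) ->
    measurable_fun setT (fun p : (T * rV) * rV => U p.1.1 p.1.2 - U p.1.1 p.2).
  move=> mU; apply: measurable_funB.
    by apply: (measurableT_comp mU); exact: measurable_fst.
  exact: (measurableT_comp mU (measurable_fun_pair m1 m3)).
apply: measurable_funM; first by apply: measurable_funM; exact: mpair.
rewrite (_ : (fun _ => _) = (fun p : (T * rV) * rV =>
    enorm (p.1.2 - p.2) `^ (- (N%:R + 2 * r)))); last first.
  by apply/funext => p; rewrite powRN.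
apply: (measurableT_comp (measurable_powR _)).
apply: (measurableT_comp measurable_enorm); exact: measurable_rV_sub.
Qed.

Lemma energy_form_density_ge0 (r : R) w p : 0 <= energy_form_density r w w p.
Proof.
by rewrite /energy_form_density mulr_ge0 ?invr_ge0 ?powR_ge0// -expr2 sqr_ge0.
Qed.

Lemma enorm_box x y (l : R) : 0 <= l -> box x l y ->
  enorm (x - y) <= Num.sqrt N%:R * l.
Proof.
move=> l0 xy; rewrite /enorm -[X in _ * X](ger0_norm l0) -sqrtr_sqr -sqrtrM ?ler0n//.
rewrite ler_wsqrtr//.
apply: (@le_trans _ _ (\sum_(i < N) l ^+ 2)).
  apply: ler_sum => i _; rewrite !mxE.
  by have /andP[] := xy i => ? ?; nra.
by rewrite sumr_const card_ord mulr_natl.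
Qed.

Lemma sqr_diff_le_energy_density (r l : R) w x y : 0 < r -> 0 <= l ->
  box x l y ->
  (w x - w y) ^+ 2 <=
    (Num.sqrt N%:R * l) `^ (N%:R + 2 * r) * energy_form_density r w w (x, y).
Proof.
move=> r0 l0 xy; have p0 : 0 < N%:R + 2 * r by rewrite ltr_wpDl// mulr_gt0.
have [xy0|xy0] := eqVneq (enorm (x - y)) 0.
  move/enorm_eq0/eqP: xy0; rewrite subr_eq0 => /eqP ->.
  by rewrite subrr expr0n mulr_ge0 ?powR_ge0 ?energy_form_density_ge0.
rewrite /energy_form_density/= -expr2 mulrCA ler_peMr ?sqr_ge0//.
rewrite ler_pdivlMr ?powR_gt0 ?lt_neqAle 1?eq_sym ?xy0 ?enorm_ge0// mul1r.
apply: ge0_ler_powR; rewrite ?nnegrE ?enorm_ge0 ?mulr_ge0 ?sqrtr_ge0 ?(ltW p0)//.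
exact: enorm_box.
Qed.

Lemma measurable_energy_form_density_at d (T : measurableType d) (r : R)
    (V W : T -> rV -> R) (t : T) :
  measurable_fun setT (fun p : T * rV => V p.1 p.2) ->
  measurable_fun setT (fun p : T * rV => W p.1 p.2) ->
  measurable_fun setT (energy_form_density r (V t) (W t)).
Proof.
move=> mV mW; have mf := measurable_energy_form_density r mV mW.
rewrite (_ : energy_form_density _ _ _ =
    (fun q : (T * rV) * rV =>
      energy_form_density r (V q.1.1) (W q.1.1) (q.1.2, q.2)) \o
    (fun q : rV * rV => ((t, q.1), q.2))); last by apply/funext => -[].
apply: (measurableT_comp mf); apply: measurable_fun_pair; last exact: measurable_snd.
by apply: measurable_fun_pair; [exact: measurable_cst|exact: measurable_fst].
Qed.

Lemma measurable_energy_form_density_pair (r : R) w : measurable_fun setT w ->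
  measurable_fun setT (energy_form_density r w w).
Proof.
move=> mw; have mW : measurable_fun setT (fun p : unit * rV => w p.2).
  by apply: (measurableT_comp mw); exact: measurable_snd.
exact: (@measurable_energy_form_density_at _ unit r (fun=> w) (fun=> w) tt mW mW).
Qed.

Lemma measurable_energy_form_density_slice (r : R) w x : measurable_fun setT w ->
  measurable_fun setT (fun y => energy_form_density r w w (x, y)).
Proof.
by move=> mw; exact: (measurable_fun_pair2 x (measurable_energy_form_density_pair r mw)).
Qed.

End energy_density.

(** * Interpolation of L log L between mass and energy *)

Section interpolation_inequality.
Context {R : realType} {N : nat}.
Local Notation mu := (@lebesgue_rV R N).
Local Notation rV := 'rV[R]_N.
Variables (r : R) (r0 : 0 < r).
Implicit Types (x y : rV) (v w : rV -> R).

(** On the cube of side l at x, w(x)^2 <= (w(x) - w(y))^2 + 2 w(x) w(y).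
    Integrated in y, the last term is at most 2 w(x) M, that is, at most half of
    the left-hand side w(x)^2 l^N as soon as w(x) >= 4 M l^(-N). *)
Lemma sqr_le_local_energy (l M : R) w x : 0 < l -> measurable_fun setT w ->
  (forall y, 0 <= w y) -> (\int[mu]_y (w y)%:E <= M%:E)%E ->
  4 * M <= w x * l ^+ N ->
  ((w x ^+ 2)%:E <= (2 * (Num.sqrt N%:R * l) `^ (N%:R + 2 * r) / l ^+ N)%:E *
    \int[mu]_y (energy_form_density r w w (x, y))%:E)%E.
Proof.
move=> l0 mw w0 wM xM; set D := _ `^ _.
have D0 : 0 <= D by exact: powR_ge0.
have lN : 0 < l ^+ N by rewrite exprn_gt0.
pose I := (\int[mu]_y (energy_form_density r w w (x, y))%:E)%E.
have I0 : (0 <= I)%E.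
  by apply: integral_ge0 => y _; rewrite lee_fin energy_form_density_ge0.
have mI := measurable_energy_form_density_slice r x mw.
have mB := measurable_box x l.
have main : ((w x ^+ 2 * l ^+ N)%:E <= D%:E * I + (2 * w x * M)%:E)%E.
  apply: (@le_trans _ _ (\int[mu]_(y in box x l) (w x ^+ 2)%:E)%E).
    by rewrite integral_cst//= lebesgue_box ?(ltW l0)// EFinM.
  apply: (@le_trans _ _ (\int[mu]_(y in box x l)
      ((D * energy_form_density r w w (x, y))%:E + (2 * w x * w y)%:E))%E).
    apply: ge0_le_integral => //.
    - by move=> y _; rewrite lee_fin sqr_ge0.
    - apply: measurable_funTS; apply: emeasurable_funD; apply/measurable_EFinP.
        exact: measurable_funM.
      exact: measurable_funM.
    - move=> y xy; rewrite -EFinD lee_fin.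
      have := sqr_diff_le_energy_density w r0 (ltW l0) xy; rewrite -/D.
      have := sqr_ge0 (w y); nra.
  have m1 : measurable_fun (box x l) (fun y => (D * energy_form_density r w w (x, y))%:E).
    by apply: measurable_funTS; apply/measurable_EFinP; exact: measurable_funM.
  have m2 : measurable_fun (box x l) (fun y => (2 * w x * w y)%:E).
    by apply: measurable_funTS; apply/measurable_EFinP; exact: measurable_funM.
  rewrite ge0_integralD//; last 2 first.
  - by move=> y _; rewrite lee_fin mulr_ge0 ?energy_form_density_ge0.
  - by move=> y _; rewrite lee_fin !mulr_ge0.
  apply: leeD.
    under eq_integral do rewrite EFinM.
    rewrite ge0_integralZl_EFin//; last 2 first.
    - by move=> y _; rewrite lee_fin energy_form_density_ge0.
    - by apply: measurable_funTS; exact/measurable_EFinP.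
    apply: lee_wpmul2l; first by rewrite lee_fin.
    apply: ge0_subset_integral => //; first exact/measurable_EFinP.
    by move=> y _; rewrite lee_fin energy_form_density_ge0.
  under eq_integral do rewrite EFinM.
  rewrite ge0_integralZl_EFin ?mulr_ge0//; last 2 first.
  - by move=> y _; rewrite lee_fin.
  - by apply: measurable_funTS; exact/measurable_EFinP.
  rewrite (EFinM _ M); apply: lee_wpmul2l; first by rewrite lee_fin mulr_ge0.
  apply: le_trans wM; apply: ge0_subset_integral => //; first exact/measurable_EFinP.
  by move=> y _; rewrite lee_fin.
move: I0 main; rewrite -/I; case: I => [a||//]; last first.
  move=> _ main.
  have [D00|Dp] := eqVneq D 0.
    rewrite D00 mulr0 !mul0r mul0e.
    move: main; rewrite D00 mul0e add0e !lee_fin => main.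
    suff : w x ^+ 2 * l ^+ N <= 0 by rewrite pmulr_lle0.
    have := w0 x; nra.
  rewrite mulry gtr0_sg ?mul1e ?leey// !mulr_gt0 ?invr_gt0//.
  by rewrite lt_neqAle eq_sym Dp.
rewrite lee_fin => a0; rewrite -EFinM -EFinD !lee_fin => main.
rewrite mulrAC ler_pdivlMr//.
have := w0 x; nra.
Qed.

(** Where w is below max(1, 4 M l^(-N)), 1 + v is below 3 + 4 M l^(-N); elsewhere
    v = w + 1 <= 2 w, so that v log(1 + v) <= v^2 <= 4 w^2 is controlled by the
    local energy. *)
Lemma LlogL_interpolation (l M : R) v : 0 < l -> 0 <= M ->
  0 < energy_form_const N r -> measurable_fun setT v ->
  (forall y, 0 <= v y) -> (\int[mu]_y (v y)%:E = M%:E)%E ->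
  (LlogL_integral v <= (M * ln (3 + 4 * M / l ^+ N))%:E +
     (8 * Num.sqrt N%:R `^ (N%:R + 2 * r) * l `^ (2 * r) / energy_form_const N r)%:E
       * energy_form r (trunc_above1 v) (trunc_above1 v))%E.
Proof.
move=> l0 M0 c0 mv v0 vM.
pose w := trunc_above1 v; set K := Num.sqrt N%:R `^ _.
have mw : measurable_fun setT w.
  apply: measurable_maxr; last exact: measurable_cst.
  by apply: measurable_funB => //; exact: measurable_cst.
have w0 y : 0 <= w y by rewrite /w /trunc_above1 le_max lexx orbT.
have wv y : w y <= v y.
  by rewrite /w /trunc_above1 ge_max v0 andbT lerBlDr lerDl.
have wM : (\int[mu]_y (w y)%:E <= M%:E)%E.
  rewrite -vM; apply: ge0_le_integral => //.
  - by move=> y _; rewrite lee_fin.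
  - exact/measurable_EFinP.
  - exact/measurable_EFinP.
  - by move=> y _; rewrite lee_fin.
have lN : 0 < l ^+ N by rewrite exprn_gt0.
set A := 3 + 4 * M / l ^+ N.
have A0 : 3 <= A by rewrite lerDl divr_ge0 ?mulr_ge0// ltW.
have lA : 0 <= ln A by apply: ln_ge0; apply: le_trans A0; rewrite ler1n.
have K0 : 0 <= K by exact: powR_ge0.
pose B : R := 8 * K * l `^ (2 * r).
have B0 : 0 <= B by rewrite !mulr_ge0 ?powR_ge0.
pose J x := (\int[mu]_y (energy_form_density r w w (x, y))%:E)%E.
have J0 x : (0 <= J x)%E.
  by apply: integral_ge0 => y _; rewrite lee_fin energy_form_density_ge0.
have md : measurable_fun setT (EFin \o energy_form_density r w w).
  by apply/measurable_EFinP; exact: measurable_energy_form_density_pair.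
have d0 p : (0 <= (EFin \o energy_form_density r w w) p)%E.
  by rewrite lee_fin energy_form_density_ge0.
have mJ : measurable_fun setT J.
  exact: (measurable_fun_fubini_tonelli_F (m2 := mu) _ md d0).
have JE : (\int[mu]_x J x = \int[mu \x mu]_p (energy_form_density r w w p)%:E)%E.
  by rewrite (fubini_tonelli1 _ md d0).
have pw x : ((v x * ln (1 + v x))%:E <= (v x * ln A)%:E + B%:E * J x)%E.
  have v1 : 0 < 1 + v x by rewrite ltr_wpDr.
  have [xs|xl] := ltP (w x) (Num.max 1 (4 * M / l ^+ N)).
    rewrite -[leLHS]adde0; apply: leeD; last by rewrite mule_ge0// lee_fin.
    rewrite lee_fin ler_wpM2l// ler_ln ?posrE//; last exact: lt_le_trans A0.
    have : v x - 1 <= w x by rewrite /w /trunc_above1 le_max lexx.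
    have : Num.max 1 (4 * M / l ^+ N) <= 1 + 4 * M / l ^+ N.
      have ? : 0 <= 4 * M / l ^+ N by rewrite divr_ge0 ?mulr_ge0// ltW.
      by rewrite ge_max lerDl lerDr ler01 andbT.
    rewrite /A; lra.
  move: xl; rewrite ge_max => /andP[x1 xM].
  have vw : v x = w x + 1.
    move: x1; rewrite /w /trunc_above1 /Num.max; case: ifPn => _.
      by rewrite ler10.
    by rewrite subrK.
  rewrite -[leLHS]add0e; apply: leeD; first by rewrite lee_fin mulr_ge0.
  have h : 4 * M <= w x * l ^+ N by rewrite -ler_pdivrMr.
  have := sqr_le_local_energy l0 mw w0 wM h.
  rewrite -/(J x) => /(lee_wpmul2l (x := 4%:E)) => /(_ (ltac:(by rewrite lee_fin))).
  rewrite muleA -!EFinM.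
  have -> : 4 * (2 * (Num.sqrt N%:R * l) `^ (N%:R + 2 * r) / l ^+ N) = B.
    rewrite powRM ?sqrtr_ge0 ?(ltW l0)// -/K powRD; last by rewrite (gt_eqF l0) implybT.
    rewrite powR_mulrn ?(ltW l0)// /B; field.
    by rewrite gt_eqF.
  apply: le_trans; rewrite lee_fin.
  have := le_ln1Dx (x := v x) (ltac:(by apply: lt_le_trans (v0 x); rewrite ltrN10)).
  nra.
rewrite /LlogL_integral.
apply: (@le_trans _ _ (\int[mu]_x ((v x * ln A)%:E + B%:E * J x))%E).
  apply: ge0_le_integral => //.
  - by move=> x _; rewrite lee_fin mulr_ge0// ln_ge0// lerDl.
  - apply/measurable_EFinP; apply: measurable_funM => //.
    by apply: (measurableT_comp (@measurable_ln R)); exact: measurable_funD.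
  - apply: emeasurable_funD; last exact: measurable_funeM.
    by apply/measurable_EFinP; exact: measurable_funM.
rewrite ge0_integralD//; last 4 first.
- by move=> x _; rewrite lee_fin mulr_ge0.
- by apply/measurable_EFinP; exact: measurable_funM.
- by move=> x _; rewrite mule_ge0// lee_fin.
- exact: measurable_funeM.
apply: leeD.
  under eq_integral do rewrite mulrC EFinM.
  rewrite ge0_integralZl_EFin//; last 2 first.
  - by move=> y _; rewrite lee_fin.
  - exact/measurable_EFinP.
  by rewrite vM -EFinM mulrC.
rewrite ge0_integralZl_EFin// JE /energy_form muleA -EFinM -/w.
by rewrite divfK// gt_eqF.
Qed.

End interpolation_inequality.

(** * Primitives and smooth functions of one variable *)

Section primitives.
Context {R : realType}.
Local Notation leb := (@lebesgue_measure R).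
Implicit Types g : R -> R.

Lemma continuous_integrable_itv g (a b : R) : continuous g ->
  leb.-integrable `[a, b] (EFin \o g).
Proof.
move=> cg; apply: continuous_compact_integrable; first exact: segment_compact.
exact: continuous_subspaceT.
Qed.

Lemma primitive_diff_ge g (c a b : R) : continuous g -> 0 <= a -> a <= b ->
  (forall y, a <= y <= b -> c <= g y) ->
  c * (b - a) <= \int[leb]_(y in `[0, b]) g y - \int[leb]_(y in `[0, a]) g y.
Proof.
move=> cg a0 ab cle.
rewrite Rintegral_itvB ?bnd_simp//; last exact: continuous_integrable_itv.
have ig : leb.-integrable `]a, b] (EFin \o g).
  apply: integrableS (continuous_integrable_itv a b cg) => //.
  exact: subset_itv_oc_cc.
have ic : leb.-integrable `]a, b] (EFin \o (fun=> c)).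
  apply: integrableS (continuous_integrable_itv a b (@cst_continuous _ _ c)) => //.
  exact: subset_itv_oc_cc.
rewrite (_ : c * (b - a) = \int[leb]_(y in `]a, b]) c).
  apply: le_Rintegral => // y /=; rewrite in_itv/= => /andP[ay yb].
  by apply: cle; rewrite (ltW ay).
rewrite Rintegral_cst//= lebesgue_measure_itv/= lte_fin.
by move: ab; rewrite le_eqVlt => /predU1P[->|->//]; rewrite ltxx subrr.
Qed.

Lemma primitive_neg g (z : R) : z < 0 -> \int[leb]_(y in `[0, z]) g y = 0.
Proof. by move=> z0; rewrite set_itv_ge ?Rintegral_set0// bnd_simp -ltNge. Qed.

Lemma primitive_le g (c z : R) : continuous g -> 0 <= z ->
  (forall y, 0 <= y <= z -> g y <= c) ->
  \int[leb]_(y in `[0, z]) g y <= c * z.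
Proof.
move=> cg z0 gc.
rewrite (_ : c * z = \int[leb]_(y in `[0, z]) c).
  apply: le_Rintegral => //; try exact: continuous_integrable_itv.
    by apply: continuous_integrable_itv; exact: cst_continuous.
rewrite Rintegral_cst//= lebesgue_measure_itv/= lte_fin.
by move: z0; rewrite le_eqVlt => /predU1P[<-|->]; rewrite ?ltxx ?mulr0//= subr0.
Qed.

Lemma primitive_nondecreasing g : continuous g -> (forall y, 0 <= g y) ->
  {homo (fun z => \int[leb]_(y in `[0, z]) g y) : a b / a <= b}.
Proof.
move=> cg g0 a b ab; have [a0|a0] := leP 0 a; last first.
  by rewrite (primitive_neg _ a0) Rintegral_ge0.
by rewrite -subr_ge0 (le_trans _ (@primitive_diff_ge g 0 a b cg a0 ab _)) ?mul0r.
Qed.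

(** A class of functions that contains the ones used below and is closed under
    derivation, so that all its members are smooth. *)
Inductive elementary : (R -> R) -> Prop :=
| elementary_cst c : elementary (fun=> c)
| elementary_id : elementary id
| elementary_add f g : elementary f -> elementary g -> elementary (fun z => f z + g z)
| elementary_mul f g : elementary f -> elementary g -> elementary (fun z => f z * g z)
| elementary_inv f : (forall z, 0 < f z) -> elementary f -> elementary (fun z => (f z)^-1)
| elementary_ln f : (forall z, 0 < f z) -> elementary f -> elementary (fun z => ln (f z)).

Lemma elementary_derive f : elementary f ->
  exists2 g, elementary g & forall z, is_derive z (1 : R) (f : R -> R^o) (g z : R^o).
Proof.
elim=> {f} [c| |f g ef [f' ef' df] eg [g' eg' dg]|f g ef [f' ef' df] eg [g' eg' dg]
  |f f0 ef [f' ef' df]|f f0 ef [f' ef' df]].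
- by exists (fun=> 0); [exact: elementary_cst|move=> z; exact: is_derive_cst].
- by exists (fun=> 1); [exact: elementary_cst|move=> z; exact: is_derive_id].
- exists (fun z => f' z + g' z); first exact: elementary_add.
  by move=> z; exact: is_deriveD.
- exists (fun z => f z * g' z + g z * f' z).
    by apply: elementary_add; exact: elementary_mul.
  by move=> z; exact: is_deriveM.
- exists (fun z => (- 1 * ((f z)^-1 * (f z)^-1)) * f' z).
    apply: elementary_mul => //; apply: elementary_mul; first exact: elementary_cst.
    by apply: elementary_mul; exact: elementary_inv.
  move=> z; have fz : f z != 0 by rewrite gt_eqF.
  have := is_deriveV fz (df z).
  by rewrite /GRing.scale/= mulN1r -expr2 exprVn.
- exists (fun z => (f z)^-1 * f' z).
    by apply: elementary_mul => //; exact: elementary_inv.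
  by move=> z; exact: is_derive1_comp (is_derive1_ln (f0 z)) (df z).
Qed.

Lemma elementary_smooth f : elementary f -> smooth f.
Proof.
move=> ef n z; suff : elementary (derive1n n f).
  by move=> /elementary_derive[g _ /(_ z)] [].
elim: n => [//|n]; rewrite derive1nS => /elementary_derive[g eg dg].
rewrite (_ : derive1 _ = g)//; apply/funext => y.
by rewrite derive1E; have [_ ->] := dg y.
Qed.

Lemma smooth_continuous (f : R -> R) : smooth f -> continuous f /\ continuous (derive1 f).
Proof.
move=> sf; split=> z; apply/differentiable_continuous/derivable1_diffP.
  exact: (sf 0%N z).
exact: (sf 1%N z).
Qed.

End primitives.

(** * A bounded substitute for the logarithm *)

Section entropy.
Context {R : realType}.
Local Notation leb := (@lebesgue_measure R).
Variables (e : R) (e01 : 0 < e < 1).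
Let e0 : 0 < e. Proof. by case/andP: e01. Qed.
Let e1 : e < 1. Proof. by case/andP: e01. Qed.

(** It behaves like 2 ln z for 1 << z << e^(-1/2), and is bounded by - ln e. *)
Definition log_cutoff (z : R) : R := ln (1 + z ^+ 2) - ln (1 + e * z ^+ 2).

Let p1 (z : R) : 0 < 1 + z ^+ 2. Proof. by rewrite ltr_wpDr ?sqr_ge0. Qed.
Let pe (z : R) : 0 < 1 + e * z ^+ 2.
Proof. by apply: ltr_wpDr => //; apply: mulr_ge0; [exact: ltW|exact: sqr_ge0]. Qed.

Lemma log_cutoff_smooth : smooth log_cutoff.
Proof.
apply: elementary_smooth.
have esq : elementary (fun z : R => z ^+ 2).
  by apply: (elementary_mul (f := id) (g := id)); exact: elementary_id.
rewrite (_ : log_cutoff =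
    (fun z => ln (1 + z ^+ 2) + - 1 * ln (1 + e * z ^+ 2))); last first.
  by apply/funext => z; rewrite mulN1r.
apply: elementary_add.
  apply: elementary_ln => //; apply: elementary_add => //; exact: elementary_cst.
apply: elementary_mul; first exact: elementary_cst.
apply: elementary_ln => //; apply: elementary_add; first exact: elementary_cst.
by apply: elementary_mul => //; exact: elementary_cst.
Qed.

Lemma log_cutoff_ge0 z : 0 <= log_cutoff z.
Proof.
by rewrite subr_ge0 ler_ln ?posrE// lerD2l ler_piMl ?sqr_ge0 ?(ltW e1).
Qed.

Lemma log_cutoff_le_ln z : log_cutoff z <= ln (1 + z ^+ 2).
Proof. by rewrite lerBlDr lerDl ln_ge0// lerDl mulr_ge0 ?sqr_ge0 ?(ltW e0). Qed.

Lemma log_cutoff_bounded : exists K : R, forall z, `|log_cutoff z| <= K.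
Proof.
exists (ln e^-1) => z; rewrite ger0_norm ?log_cutoff_ge0// /log_cutoff -ln_div ?posrE//.
rewrite ler_ln ?posrE ?divr_gt0 ?invr_gt0// ler_pdivrMr// mulrDr mulr1 mulrA.
by rewrite mulVf ?gt_eqF// mul1r lerD2r -[leLHS]invr1 lef_pV2 ?posrE// ltW.
Qed.

Lemma derive1_log_cutoff z : derive1 log_cutoff z =
  2 * (1 - e) * z / ((1 + z ^+ 2) * (1 + e * z ^+ 2)).
Proof.
have dsq : is_derive z (1 : R) (fun y : R => y ^+ 2 : R^o) (2 * z).
  have := is_deriveX 2 (is_derive_id z (1 : R)).
  by rewrite /GRing.scale/= mulr1 expr1.
have d1 : is_derive z (1 : R) (fun y : R => 1 + y ^+ 2 : R^o) (2 * z).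
  rewrite -[X in is_derive _ _ _ X]add0r.
  exact: is_deriveD (is_derive_cst _ _ _) dsq.
have de : is_derive z (1 : R) (fun y : R => 1 + e * y ^+ 2 : R^o) (e * (2 * z)).
  rewrite -[X in is_derive _ _ _ X]add0r.
  exact: is_deriveD (is_derive_cst _ _ _) (is_deriveZ e dsq).
have dl1 := is_derive1_comp (g := fun y : R => 1 + y ^+ 2) (is_derive1_ln (p1 z)) d1.
have dle := is_derive1_comp (g := fun y : R => 1 + e * y ^+ 2) (is_derive1_ln (pe z)) de.
have d := is_deriveB dl1 dle.
rewrite derive1E (_ : log_cutoff = (@ln R \o (fun y : R => 1 + y ^+ 2)) -
  (@ln R \o (fun y : R => 1 + e * y ^+ 2)))//.
have [_ ->] := d.
by field; rewrite !gt_eqF ?p1 ?pe.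
Qed.

Definition entropy (z : R) : R := \int[leb]_(y in `[0, z]) log_cutoff y.

Let cf : continuous log_cutoff.
Proof. by have [] := smooth_continuous log_cutoff_smooth. Qed.

Lemma measurable_entropy : measurable_fun [set: R] entropy.
Proof.
apply: nondecreasing_measurable => //.
exact: primitive_nondecreasing cf log_cutoff_ge0.
Qed.

Lemma entropy_ge0 z : 0 <= entropy z.
Proof. by apply: Rintegral_ge0 => y _; exact: log_cutoff_ge0. Qed.

Lemma entropy_le z : 0 <= z -> entropy z <= 2 * (z * ln (1 + z)).
Proof.
move=> z0; rewrite mulrCA mulrC; apply: primitive_le => // y /andP[y0 yz].
apply: le_trans (log_cutoff_le_ln y) _.
rewrite mulr_natl -lnXn; last by rewrite ltr_pwDl.
rewrite ler_ln ?posrE ?exprn_gt0//; first nra.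
by rewrite ltr_pwDl.
Qed.

(** On the upper half [z / 2, z] of the interval of integration the integrand is at
    least 2 ln((1 + z) / 4). *)
Lemma entropy_ge K z : 0 <= z <= K -> e * K ^+ 2 <= 1 ->
  z * ln (1 + z) - z * ln 4 <= entropy z.
Proof.
move=> /andP[z0 zK] eK.
have z2 : z / 2 <= z by lra.
have z20 : 0 <= z / 2 by lra.
have := @primitive_diff_ge R log_cutoff (2 * (ln (1 + z) - ln 4)) (z / 2) z cf z20 z2.
have -> : 2 * (ln (1 + z) - ln 4) * (z - z / 2) = z * ln (1 + z) - z * ln 4 by field.
move=> H; apply: (le_trans (H _)) => [y /andP[y1 y2]|]; last first.
  by rewrite lerBlDr lerDl Rintegral_ge0// => y _; exact: log_cutoff_ge0.
rewrite /log_cutoff -!ln_div ?posrE//; last by rewrite ltr_pwDl.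
rewrite mulr_natl -lnXn; last by rewrite divr_gt0// ltr_pwDl.
rewrite ler_ln ?posrE ?exprn_gt0 ?divr_gt0//; last by rewrite ltr_pwDl.
rewrite ler_pdivlMr//.
have ey : e * y ^+ 2 <= 1.
  by apply: le_trans eK; rewrite ler_pM2l//; nra.
have q0 : 0 <= ((1 + z) / 4) ^+ 2 by exact: sqr_ge0.
apply: (@le_trans _ _ (((1 + z) / 4) ^+ 2 * 2)).
  by rewrite ler_wpM2l//; lra.
have -> : ((1 + z) / 4) ^+ 2 * 2 = (1 + z) ^+ 2 / 8 by field.
have := sqr_ge0 (1 - z); nra.
Qed.

Let cg : continuous (fun y : R => y * derive1 log_cutoff y).
Proof.
move=> z; apply: continuousM; first exact: cvg_id.
by have [_] := smooth_continuous log_cutoff_smooth; apply.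
Qed.

Lemma dissipation_primitive_nondecreasing :
  {homo weighted_primitive log_cutoff : a b / a <= b}.
Proof.
apply: primitive_nondecreasing cg _ => y; rewrite derive1_log_cutoff.
rewrite (_ : y * _ = 2 * (1 - e) * y ^+ 2 / ((1 + y ^+ 2) * (1 + e * y ^+ 2))).
  apply: divr_ge0; last by apply: ltW; exact: mulr_gt0.
  apply: mulr_ge0; last exact: sqr_ge0.
  by apply: mulr_ge0 => //; rewrite subr_ge0 ltW.
by rewrite expr2; ring.
Qed.

Lemma dissipation_primitive_ge K a b : 1 <= K -> e * K ^+ 2 <= 1 / 3 ->
  0 <= a -> a <= b -> b <= K ->
  (Num.max (b - 1) 0 - Num.max (a - 1) 0) / 2 <=
    weighted_primitive log_cutoff b - weighted_primitive log_cutoff a.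
Proof.
move=> K1 eK a0 ab bK.
have [b1|b1] := leP b 1.
  have -> : Num.max (b - 1) 0 = 0 by apply/max_idPr; lra.
  have -> : Num.max (a - 1) 0 = 0 by apply/max_idPr; lra.
  by rewrite subrr mul0r subr_ge0 dissipation_primitive_nondecreasing.
pose a' := Num.max a 1.
have a'1 : 1 <= a' by rewrite le_max lexx orbT.
have aa' : a <= a' by rewrite le_max lexx.
have a'b : a' <= b by rewrite ge_max ab ltW.
have -> : Num.max (b - 1) 0 = b - 1 by apply/max_idPl; lra.
have -> : Num.max (a - 1) 0 = a' - 1.
  rewrite /a'; have [a1|a1] := leP a 1.
    by rewrite subrr; apply/max_idPr; lra.
  by apply/max_idPl; lra.
apply: (@le_trans _ _ (weighted_primitive log_cutoff b -
  weighted_primitive log_cutoff a')); last first.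
  by rewrite lerD2l lerN2 dissipation_primitive_nondecreasing.
have a'0 : 0 <= a' by lra.
have := @primitive_diff_ge R _ (1 / 2) a' b cg a'0 a'b.
have -> : 1 / 2 * (b - a') = (b - 1 - (a' - 1)) / 2 by field.
apply => y /andP[y1 y2].
have ey : e * y ^+ 2 <= 1 / 3.
  by apply: le_trans eK; rewrite ler_pM2l//; nra.
have e13 : e <= 1 / 3 by apply: le_trans eK; rewrite ler_peMr ?(ltW e0)//; nra.
rewrite derive1_log_cutoff mulrA ler_pdivlMr ?mulr_gt0//.
have y21 : 1 <= y ^+ 2 by nra.
apply: (@le_trans _ _ (1 / 2 * ((1 + y ^+ 2) * (4 / 3)))).
  by rewrite ler_wpM2l// ?ler_wpM2l ?(ltW (p1 _))//; lra.
nra.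
Qed.

(** Compares the integrand of B_r(G(u), u) with that of B_r(w, w), w = (u - 1)_+,
    for u with values in [0, K]: one factor uses G' >= 1/2 on [1, K], the other
    that z -> (z - 1)_+ is 1-Lipschitz. *)
Lemma dissipation_density_ge K a b : 1 <= K -> e * K ^+ 2 <= 1 / 3 ->
  0 <= a <= K -> 0 <= b <= K ->
  (Num.max (a - 1) 0 - Num.max (b - 1) 0) ^+ 2 / 2 <=
    (weighted_primitive log_cutoff a - weighted_primitive log_cutoff b) * (a - b).
Proof.
move=> K1 eK; wlog ba : a b / b <= a => [H aK bK|/andP[a0 aK] /andP[b0 bK]].
  have [/H|/ltW/H] := leP b a; first exact.
  move=> /(_ bK aK); rewrite -sqrrN opprB => h; rewrite (le_trans h)//.
  by rewrite -mulrNN !opprB.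
have := dissipation_primitive_ge K1 eK b0 ba aK.
have : 0 <= Num.max (a - 1) 0 - Num.max (b - 1) 0 <= a - b.
  rewrite /Num.max; case: ifPn; case: ifPn; rewrite -?leNgt; lra.
move=> /andP[m0 mab] h; rewrite expr2 mulrAC.
apply: ler_pM => //; by rewrite divr_ge0.
Qed.

End entropy.

(** * Integration of the energy balance in time *)

Section energy_in_time.
Context {R : realType}.
Local Notation leb := (@lebesgue_measure R).

Lemma measurable_energy_form (N : nat) (r : R) (V W : R -> 'rV[R]_N -> R) :
  measurable_fun [set: measurableTypeR R * 'rV[R]_N] (fun p => V p.1 p.2) ->
  measurable_fun [set: measurableTypeR R * 'rV[R]_N] (fun p => W p.1 p.2) ->
  (forall t p, 0 <= energy_form_density r (V t) (W t) p) ->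
  measurable_fun [set: R] (fun t => energy_form r (V t) (W t)).
Proof.
move=> mV mW d0.
pose mu := @lebesgue_rV R N.
pose f (q : (measurableTypeR R * 'rV[R]_N) * 'rV[R]_N) : \bar R :=
  (energy_form_density r (V q.1.1) (W q.1.1) (q.1.2, q.2))%:E.
have mf : measurable_fun setT f.
  by apply/measurable_EFinP; exact: (measurable_energy_form_density r mV mW).
have f0 q : (0 <= f q)%E by rewrite lee_fin.
pose g (q : measurableTypeR R * 'rV[R]_N) : \bar R := (\int[mu]_y f (q, y))%E.
have mg : measurable_fun setT g.
  exact: (measurable_fun_fubini_tonelli_F (m2 := mu) _ mf f0).
have g0 q : (0 <= g q)%E by apply: integral_ge0.
have mh := measurable_fun_fubini_tonelli_F (m2 := mu) _ mg g0.
rewrite (_ : (fun t => _) = (fun t => ((energy_form_const N r)%:E *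
    fubini_F mu g t)%E)); first exact: measurable_funeM.
apply/funext => t; rewrite /energy_form; congr (_ * _)%E.
have mt : measurable_fun setT (EFin \o energy_form_density r (V t) (W t)).
  by apply/measurable_EFinP; exact: (@measurable_energy_form_density_at _ _ _
    (measurableTypeR R) r V W t mV mW).
rewrite (fubini_tonelli1 _ mt)//.
by move=> p; rewrite lee_fin.
Qed.

Let mem_oo (a b x : R) : (x \in [set` `]a, b[]) = (a < x < b).
Proof. by apply/idP/idP; rewrite inE/= in_itv. Qed.

Lemma tonelli_triangle (d t : R) (e : R -> \bar R) :
  measurable_fun [set: R] e -> (forall y, 0 <= e y)%E ->
  measurable_fun `]d, t[ (fun x => \int[leb]_(y in `]x, t[) e y)%E /\
  (\int[leb]_(x in `]d, t[) \int[leb]_(y in `]x, t[) e y =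
   \int[leb]_(y in `]d, t[) ((y - d)%:E * e y))%E.
Proof.
move=> me e0.
pose T := measurableTypeR R.
pose k (p : T * T) : \bar R :=
  if (d < p.1) && (p.1 < p.2) && (p.2 < t) then e p.2 else 0%E.
have k0 p : (0 <= k p)%E by rewrite /k; case: ifP.
have mfst : measurable_fun setT (fun p : T * T => p.1 : R) by exact: measurable_fst.
have msnd : measurable_fun setT (fun p : T * T => p.2 : R) by exact: measurable_snd.
have mk : measurable_fun setT k.
  apply: measurable_fun_ifT.
  - apply: measurable_and; first apply: measurable_and.
    + by apply: measurable_fun_ltr => //; exact: measurable_cst.
    + exact: measurable_fun_ltr.
    + by apply: measurable_fun_ltr => //; exact: measurable_cst.
  - exact: (measurableT_comp me msnd).
  - exact: measurable_cst.
have kE x : (\int[leb]_y k (x, y) =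
    ((fun x => \int[leb]_(y in `]x, t[) e y) \_ `]d, t[) x)%E.
  rewrite patchE mem_oo; case: ifPn => [/andP[dx xt]|xdt].
    rewrite [RHS]integral_mkcond; apply: eq_integral => y _.
    by rewrite patchE mem_oo /k/= dx.
  rewrite integral0_eq// => y _; rewrite /k/=; case: ifPn => // /andP[/andP[dx xy] yt].
  by move: xdt; rewrite dx (lt_trans xy yt).
split.
  apply/measurable_restrictT => //.
  rewrite (_ : _ \_ _ = fubini_F leb k); last by apply/funext => x; rewrite -kE.
  exact: measurable_fun_fubini_tonelli_F.
transitivity (\int[leb]_x \int[leb]_y k (x, y))%E.
  by rewrite integral_mkcond; apply: eq_integral => x _; rewrite kE.
rewrite (fubini_tonelli (m1 := leb) (m2 := leb) _ mk k0).
rewrite [RHS]integral_mkcond; apply: eq_integral => y _; rewrite patchE.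
rewrite mem_oo; case: ifPn => [/andP[dy yt]|ydt].
  have -> : (y - d)%:E = leb `]d, y[.
    by rewrite lebesgue_measure_itv/= lte_fin dy -EFinB.
  rewrite muleC -integral_cst// [RHS]integral_mkcond; apply: eq_integral => x _.
  by rewrite patchE mem_oo /k/= yt andbT.
rewrite integral0_eq// => x _; rewrite /k/=; case: ifPn => // /andP[/andP[dx xy] yt].
by move: ydt; rewrite yt (lt_trans dx xy).
Qed.

(** Here phi is the entropy, e its dissipation and B the energy of (u - 1)_+.
    Integrating the hypothesis on phi over ]d, t[ gives (t - d) phi(t) + X, with
    X the integral of (x - d) e(x), on the left; on the right it leaves a quarter
    of Y, the integral of (x - d) B(x), and Y <= 2 X, so half of X can be
    absorbed and the other half bounds Y / 4.  Subtracting X / 2 requires X to be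
    finite. *)
Lemma time_weighted_energy (d t M a q phit : R) (phi e B : R -> \bar R) :
  d < t -> t - d <= 1 -> 0 <= M -> 0 <= a -> 0 <= q -> 0 <= phit ->
  measurable_fun [set: R] e -> (forall y, 0 <= e y)%E ->
  measurable_fun [set: R] B -> (forall y, 0 <= B y)%E ->
  (\int[leb]_(y in `]d, t[) e y < +oo)%E ->
  (forall x, d < x < t -> phi x = (phit%:E + \int[leb]_(y in `]x, t[) e y)%E) ->
  (forall x : R, d < x < t -> (B x <= 2%:E * e x)%E) ->
  (forall x, d < x < t ->
    (phi x <= (2 * M * (a - q * ln (x - d)))%:E + ((x - d) / 4)%:E * B x)%E) ->
  (((t - d) * phit)%:E + 4^-1%:E * \int[leb]_(x in `]d, t[) ((x - d)%:E * B x)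
   <= (2 * M * ((t - d) * (a + q * (4 - ln (t - d)))))%:E)%E.
Proof.
move=> dt h1 M0 a0 q0 p0 me e0 mB B0 efin phiE Be phile.
set h := t - d; have hp : 0 < h by rewrite subr_gt0.
have lh : ln h <= 0 by exact: ln_le0.
pose D : set R := [set` `]d, t[].
have mD : measurable D by exact: measurable_itv.
have DE x : D x <-> d < x < t by rewrite /D/= in_itv.
have mxd : measurable_fun [set: R] (fun x : R => x - d).
  by apply: measurable_funB => //; exact: measurable_cst.
have mxde (f : R -> \bar R) : measurable_fun [set: R] f ->
    measurable_fun D (fun x => ((x - d)%:E * f x)%E).
  move=> mf; apply: measurable_funTS; apply: emeasurable_funM => //.
  exact/measurable_EFinP.
have xd0 (f : R -> \bar R) : (forall y, 0 <= f y)%E ->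
    forall x, D x -> (0 <= (x - d)%:E * f x)%E.
  move=> f0 x /DE/andP[dx _]; apply: mule_ge0 => //.
  by rewrite lee_fin subr_ge0 ltW.
pose X := (\int[leb]_(x in D) ((x - d)%:E * e x))%E.
pose Y := (\int[leb]_(x in D) ((x - d)%:E * B x))%E.
have X0 : (0 <= X)%E by apply: integral_ge0; exact: xd0.
have Y0 : (0 <= Y)%E by apply: integral_ge0; exact: xd0.
have Xfin : (X < +oo)%E.
  apply: (@le_lt_trans _ _ (\int[leb]_(x in D) (h%:E * e x))%E).
    apply: ge0_le_integral => //; [exact: xd0|exact: mxde| |].
      by apply: measurable_funTS; exact: measurable_funeM.
    move=> x /DE/andP[dx xt]; apply: lee_wpmul2r => //.
    by rewrite lee_fin lerD2r ltW.
  rewrite ge0_integralZl_EFin//; last 2 first.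
  - exact: measurable_funTS.
  - exact: ltW.
  by apply: lte_mul_pinfty; rewrite ?lee_fin ?(ltW hp).
have YX : (Y <= 2%:E * X)%E.
  rewrite /X -ge0_integralZl_EFin//; last 2 first.
  - exact: xd0.
  - exact: mxde.
  apply: ge0_le_integral => //; [exact: xd0|exact: mxde| |].
    by apply: measurable_funeM; exact: mxde.
  move=> x Dx; rewrite muleCA; apply: lee_wpmul2l.
    by move/DE: Dx => /andP[dx _]; rewrite lee_fin subr_ge0 ltW.
  exact/Be/DE.
have Yfin : (Y < +oo)%E.
  by apply: le_lt_trans YX _; apply: lte_mul_pinfty.
(* With h = t - d, ln (h / sg) = 2 ln (h / sg)^(1/2) <= 2 (h / sg)^(1/2), which is
   integrable and replaces the integral of the logarithm. *)
pose A : R := 2 * M * (a - q * ln h).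
have A0 : 0 <= A by rewrite !mulr_ge0// subr_ge0 (le_trans _ a0)// mulr_ge0_le0.
pose C : R := 4 * M * q * h `^ 2^-1.
have C0 : 0 <= C by rewrite !mulr_ge0 ?powR_ge0.
have pw x : D x -> (phit%:E + \int[leb]_(y in `]x, t[) e y <=
    A%:E + (C%:E * ((x - d) `^ (2^-1 - 1))%:E + 4^-1%:E * ((x - d)%:E * B x)))%E.
  move=> /DE Dx; rewrite -phiE//; apply: le_trans (phile _ Dx) _.
  have -> : (4^-1%:E * ((x - d)%:E * B x) = ((x - d) / 4)%:E * B x)%E.
    by rewrite muleA -EFinM mulrC.
  rewrite addeA; apply: leeD => //.
  rewrite -EFinM -EFinD lee_fin /A /C.
  move: Dx => /andP[dx xt].
  set sg := x - d; have sg0 : 0 < sg by rewrite subr_gt0.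
  have : ln h - ln sg <= 2 * (h `^ 2^-1 * sg `^ (2^-1 - 1)).
    have hs : 0 < h / sg by exact: divr_gt0.
    have := ln_sublinear (powR_gt0 2^-1 hs); rewrite ln_powR ln_div ?posrE//.
    have -> : (2^-1 : R) - 1 = - 2^-1 by field.
    rewrite powRM ?(ltW hp) ?invr_ge0 ?(ltW sg0)//.
    have -> : sg^-1 `^ 2^-1 = sg `^ (- 2^-1).
      by rewrite -powR_inv1 ?(ltW sg0)// -powRrM mulN1r.
    lra.
  set z := _ * (_ `^ _); set z' := _ `^ (2^-1 - 1).
  move=> H.
  have -> : 4 * M * q * h `^ 2^-1 * z' = 2 * M * (q * (2 * z)).
    by rewrite /z -/z'; ring.
  rewrite -mulrDr; apply: ler_wpM2l; first exact: mulr_ge0.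
  nra.
have [mI tI] := tonelli_triangle d t me e0.
pose P (x : R) : \bar R := ((x - d) `^ (2^-1 - 1))%:E.
have mP : measurable_fun [set: R] P.
  by apply/measurable_EFinP; exact: (measurableT_comp (measurable_powR _)).
have P0 x : (0 <= P x)%E by rewrite lee_fin powR_ge0.
have intP : (\int[leb]_(x in D) P x <= (h `^ 2^-1 / 2^-1)%:E)%E.
  have hlf : 0 < 2^-1 :> R by rewrite invr_gt0.
  apply: le_trans (integral_powR_le d hp hlf); apply: ge0_subset_integral => //.
    exact: measurable_funTS.
  rewrite subrKC => x; rewrite /D/= !in_itv/= => /andP[-> xt].
  exact: ltW.
have intc c : (\int[leb]_(x in D) c%:E = (c * h)%:E)%E.
  by rewrite integral_cst//= lebesgue_measure_itv/= lte_fin dt -EFinB.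
have main : ((h * phit)%:E + X <=
    (A * h)%:E + (C%:E * (h `^ 2^-1 / 2^-1)%:E + 4^-1%:E * Y))%E.
  rewrite /X -tI.
  have -> : (h * phit)%:E = (\int[leb]_(x in D) phit%:E)%E.
    by rewrite intc mulrC.
  rewrite -ge0_integralD//; last first.
    by move=> x _; apply: integral_ge0.
  have mR1 : measurable_fun D (fun x => (4^-1%:E * ((x - d)%:E * B x))%E).
    by apply: measurable_funeM; exact: mxde.
  have mR2 : measurable_fun D (fun x => (C%:E * P x)%E).
    by apply: measurable_funeM; exact: measurable_funTS.
  have R10 x : D x -> (0 <= 4^-1%:E * ((x - d)%:E * B x))%E.
    by move=> Dx; apply: mule_ge0; [rewrite lee_fin invr_ge0|exact: xd0].
  have R20 x : D x -> (0 <= C%:E * P x)%E by move=> Dx; apply: mule_ge0.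
  apply: (@le_trans _ _ (\int[leb]_(x in D)
      (A%:E + (C%:E * P x + 4^-1%:E * ((x - d)%:E * B x))))%E).
    apply: ge0_le_integral => //.
    - by move=> x _; apply: adde_ge0 => //; apply: integral_ge0.
    - by apply: emeasurable_funD => //; exact: measurable_cst.
    - by apply: emeasurable_funD; [exact: measurable_cst|exact: emeasurable_funD].
  rewrite ge0_integralD//; last 2 first.
  - by move=> x Dx; apply: adde_ge0; [exact: R20|exact: R10].
  - exact: emeasurable_funD.
  rewrite intc; apply: leeD => //.
  rewrite ge0_integralD//; apply: leeD.
    rewrite ge0_integralZl_EFin//; last exact: measurable_funTS.
    by apply: lee_wpmul2l.
  rewrite ge0_integralZl_EFin//; [exact: xd0|exact: mxde].
move: main; rewrite -/Y -/h.
have {}Xfin : X \is a fin_num by rewrite ge0_fin_numE.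
have {}Yfin : Y \is a fin_num by rewrite ge0_fin_numE.
move: X0 Y0 YX; rewrite -(fineK Xfin) -(fineK Yfin).
move: (fine X) (fine Y) => x y; rewrite -?EFinM -?EFinD !lee_fin => x0 y0 yx.
have -> : C * (h `^ 2^-1 / 2^-1) = 8 * M * q * h.
  have hh : h `^ 2^-1 * h `^ 2^-1 = h.
    by rewrite powR12_sqrt ?(ltW hp)// -expr2 sqr_sqrtr// ltW.
  by rewrite -[in RHS]hh /C invrK; ring.
rewrite /A; lra.
Qed.

End energy_in_time.

(** * The smoothing estimate *)

Section constants.
Context {R : realType}.
Variables (N : nat) (r : R).

(** The interpolation inequality is used with l^(2r) = energy_scale * (tau - d):
    64 = 2 * 8 * 4, where 2 is the constant in F(z) <= 2 z log(1 + z), 8 the one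
    of the interpolation inequality, and 1/4 the part of the energy that can be
    absorbed. *)
Definition energy_scale : R :=
  energy_form_const N r / (64 * Num.sqrt N%:R `^ (N%:R + 2 * r)).

(** l^N is a multiple of the power smoothing_exponent of tau - d. *)
Definition smoothing_exponent : R := N%:R / (2 * r).

Definition log_threshold : R := ln (3 + 4 / energy_scale `^ smoothing_exponent).

Definition smoothing_const (kappa : R) : R :=
  (4 * ln 4 + 16 * log_threshold + 16 * (1 + smoothing_exponent) * (4 + ln 2))
    / (- ln kappa) + 16 * (1 + smoothing_exponent).

Lemma smoothing_exponent_ge0 : 0 < r -> 0 <= smoothing_exponent.
Proof. by move=> r0; rewrite divr_ge0// mulr_ge0// ltW. Qed.

Lemma log_threshold_ge0 : 0 <= log_threshold.
Proof.
apply: ln_ge0; apply: (@le_trans _ _ 3); first by rewrite ler1n.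
by rewrite lerDl divr_ge0 ?powR_ge0.
Qed.

Lemma smoothing_const_gt0 (kappa : R) : 0 < r -> 0 < kappa < 1 ->
  0 < smoothing_const kappa.
Proof.
move=> r0 k01; have p0 := smoothing_exponent_ge0 r0.
have a0 := log_threshold_ge0.
have ln4 : 0 <= ln 4 :> R by rewrite ln_ge0// ler1n.
have ln2 : 0 <= ln 2 :> R by rewrite ln_ge0// ler1n.
apply: ltr_wpDl; last by rewrite mulr_gt0// ltr_pwDl.
rewrite divr_ge0 ?addr_ge0 ?mulr_ge0 ?addr_ge0//.
by rewrite oppr_ge0 ltW// ln_lt0.
Qed.

End constants.

Section smoothing.
Context {R : realType} {N : nat}.
Local Notation leb := (@lebesgue_measure R).
Local Notation mu := (@lebesgue_rV R N).
Local Notation rV := 'rV[R]_N.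

Lemma measurable_slice (U : R -> rV -> R) (t : R) :
  measurable_fun [set: measurableTypeR R * rV] (fun p => U p.1 p.2) ->
  measurable_fun setT (U t).
Proof. by move=> mU; exact: (measurable_fun_pair2 t mU). Qed.

Lemma LlogL_bounded (v : rV -> R) (M K : R) : measurable_fun setT v ->
  (forall x, 0 <= v x <= K) -> (\int[mu]_x (v x)%:E = M%:E)%E -> LlogL v.
Proof.
move=> mv vK vM; rewrite /LlogL /LlogL_integral.
have v0 x : 0 <= v x by have /andP[] := vK x.
have K0 : 0 <= K by have /andP[/le_trans] := vK 0; apply.
apply: (@le_lt_trans _ _ (\int[mu]_x ((ln (1 + K))%:E * (v x)%:E))%E).
  apply: ge0_le_integral => //.
  - by move=> x _; rewrite lee_fin mulr_ge0// ln_ge0// lerDl.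
  - apply/measurable_EFinP; apply: measurable_funM => //.
    by apply: (measurableT_comp (@measurable_ln R)); exact: measurable_funD.
  - by apply: measurable_funeM; exact/measurable_EFinP.
  - move=> x _; rewrite -EFinM lee_fin mulrC ler_wpM2r//.
    have /andP[_ xK] := vK x.
    by rewrite ler_ln ?posrE ?lerD2l// ltr_pwDl.
rewrite ge0_integralZl_EFin//.
- by rewrite vM -EFinM ltry.
- by move=> x _; rewrite lee_fin.
- exact/measurable_EFinP.
- by rewrite ln_ge0// lerDl.
Qed.

(** The argument 3 + 4 M l^(-N) of the logarithm in the interpolation inequality,
    for l^(2r) = b sg, is at most a multiple of sg^(-(1 + p)): p of these powers
    come from l^(-N) and the remaining one from M <= 1 / sg. *)
Lemma log_threshold_le (b p sg M : R) : 0 < b -> 0 <= p -> 0 < sg <= 1 ->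
  0 <= M -> M * sg <= 1 ->
  ln (3 + 4 * M / (b * sg) `^ p) <= ln (3 + 4 / b `^ p) - (1 + p) * ln sg.
Proof.
move=> b0 p0 /andP[s0 s1] M0 Ms.
have bp : 0 < b `^ p by exact: powR_gt0.
have sp : 0 < sg `^ p by exact: powR_gt0.
have s1p : 0 < sg `^ (1 + p) by exact: powR_gt0.
have s1p1 : sg `^ (1 + p) <= 1.
  rewrite -[leRHS](powRr0 sg); apply: ger_powR; first by rewrite s0.
  exact: addr_ge0.
have s1pE : sg `^ (1 + p) = sg * sg `^ p.
  by rewrite powRD ?powRr1 ?(ltW s0)//; apply/implyP => _; rewrite gt_eqF.
rewrite -ln_powR -ln_div ?posrE//; last by rewrite addr_gt0// divr_gt0.
rewrite ler_ln ?posrE; last 2 first.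
- by rewrite ltr_pwDl// divr_ge0 ?mulr_ge0 ?powR_ge0.
- by rewrite divr_gt0// addr_gt0// divr_gt0.
rewrite ler_pdivlMr// powRM ?(ltW b0) ?(ltW s0)// mulrDl.
apply: lerD; first by rewrite ler_piMr.
rewrite s1pE.
have -> : 4 * M / (b `^ p * sg `^ p) * (sg * sg `^ p) = 4 * (M * sg) / b `^ p.
  by field; rewrite !gt_eqF.
by rewrite ler_pM2r ?invr_gt0// ger_pMr.
Qed.

(** U stands for the solution extended to negative times by U(0), so that it is
    jointly measurable on the whole of R x R^N. *)
Section solution.
Variables (r M : R) (U : R -> rV -> R).
Hypothesis N1 : (1 <= N)%N.
Hypothesis r0 : 0 < r.
Hypothesis c0 : 0 < energy_form_const N r.
Hypothesis mU : measurable_fun [set: measurableTypeR R * rV] (fun p => U p.1 p.2).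
Hypothesis U0 : forall t x, 0 <= U t x.
Hypothesis UM : forall t, (\int[mu]_x (U t x)%:E = M%:E)%E.
Hypothesis Ubd : forall d : R, 0 < d ->
  exists K : R, forall t x, d <= t -> U t x <= K.
Hypothesis Uen : forall T, 0 < T -> energy_identity r T U.

Let w (t : R) := trunc_above1 (U t).
Let B (t : R) := energy_form r (w t) (w t).
Local Notation b := (energy_scale N r).
Local Notation p := (smoothing_exponent N r).
Local Notation a := (log_threshold N r).

Let K_gt0 : 0 < Num.sqrt N%:R `^ (N%:R + 2 * r) :> R.
Proof. by rewrite powR_gt0// sqrtr_gt0 ltr0n. Qed.

Let b_gt0 : 0 < b.
Proof. by rewrite divr_gt0// mulr_gt0. Qed.

Let p_ge0 : 0 <= p.
Proof. exact: smoothing_exponent_ge0. Qed.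

Let a_ge0 : 0 <= a.
Proof. exact: log_threshold_ge0. Qed.

Let M_ge0 : 0 <= M.
Proof.
by rewrite -lee_fin -(UM 0); apply: integral_ge0 => x _; rewrite lee_fin.
Qed.

Let mw : measurable_fun [set: measurableTypeR R * rV] (fun q => w q.1 q.2).
Proof.
apply: measurable_maxr; last exact: measurable_cst.
by apply: measurable_funB => //; exact: measurable_cst.
Qed.

Let mB : measurable_fun [set: R] B.
Proof. by apply: measurable_energy_form => // t q; exact: energy_form_density_ge0. Qed.

Let B0 t : (0 <= B t)%E.
Proof.
apply: mule_ge0; first by rewrite lee_fin ltW.
by apply: integral_ge0 => q _; rewrite lee_fin energy_form_density_ge0.
Qed.

Lemma solution_interpolation (t sg : R) : 0 < sg <= 1 -> M * sg <= 1 ->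
  (LlogL_integral (U t) <= (M * (a - (1 + p) * ln sg))%:E + (sg / 8)%:E * B t)%E.
Proof.
move=> /andP[s0 s1] Ms.
pose l := (b * sg) `^ (2 * r)^-1.
have bs0 : 0 < b * sg by exact: mulr_gt0.
have l0 : 0 < l by exact: powR_gt0.
have r20 : 2 * r != 0 by rewrite gt_eqF// mulr_gt0.
have lr : l `^ (2 * r) = b * sg.
  by rewrite -powRrM mulVf// powRr1// ltW.
have lN : l ^+ N = (b * sg) `^ p.
  by rewrite -(powR_mulrn N (ltW l0)) -powRrM [_^-1 * _]mulrC.
have mUt := measurable_slice t mU.
have := LlogL_interpolation r0 l0 M_ge0 c0 mUt (U0 t) (UM t).
move=> /le_trans; apply; rewrite lr lN; apply: leeD.
  rewrite lee_fin ler_wpM2l//.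
  by apply: log_threshold_le => //; rewrite s0.
apply: lee_wpmul2r; first exact: B0.
rewrite lee_fin /energy_scale le_eqVlt; apply/orP; left; apply/eqP; field.
by rewrite !gt_eqF.
Qed.

Lemma solution_LlogL (t : R) : 0 < t -> LlogL (U t).
Proof.
move=> t0; have [K UK] := Ubd t0.
apply: (@LlogL_bounded (U t) M K) => //; first exact: measurable_slice.
by move=> x; rewrite U0 UK.
Qed.

(** The energy balance started at d > 0, where the solution is already bounded; the
    right-hand side no longer depends on that bound. *)
Lemma solution_energy_from (d t : R) : 0 < d < t -> t <= 1 -> M * t <= 1 ->
  exists phit : R, [/\ 0 <= phit,
    (LlogL_integral (U t) <= (phit + M * ln 4)%:E)%E &
    (((t - d) * phit)%:E + 4^-1%:E * \int[leb]_(x in `]d, t[) ((x - d)%:E * B x)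
     <= (2 * M * ((t - d) * (a + (1 + p) * (4 - ln (t - d)))))%:E)%E].
Proof.
move=> /andP[d0 dt] t1 Mt; have t0 := lt_trans d0 dt.
have [K0 UK0] := Ubd d0.
(* e K^2 = 1 / 3 makes both entropy_ge and dissipation_density_ge available up to
   the bound K of the solution on [d, t]. *)
pose K := Num.max K0 1.
have K1 : 1 <= K by rewrite le_max lexx orbT.
have UK x y : d <= x -> U x y <= K by move=> dx; rewrite le_max UK0.
pose e := (3 * K ^+ 2)^-1.
have K2 : 1 <= K ^+ 2 by nra.
have K3 : 0 < 3 * K ^+ 2 by nra.
have eK : e * K ^+ 2 <= 1 / 3.
  rewrite /e le_eqVlt; apply/orP; left; apply/eqP; field; lra.
have e01 : 0 < e < 1 by rewrite invr_gt0 K3/= invf_lt1//; lra.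
pose f := log_cutoff e.
pose F := entropy e.
pose G := weighted_primitive f.
pose phi (x : R) := (\int[mu]_y (F (U x y))%:E)%E.
pose en (x : R) := energy_form r (G \o U x) (U x).
have mF : measurable_fun [set: R] F by exact: measurable_entropy.
have ndG : {homo G : x y / x <= y} by exact: dissipation_primitive_nondecreasing.
have mG : measurable_fun [set: R] G by exact: nondecreasing_measurable.
have mGU : measurable_fun [set: measurableTypeR R * rV] (fun q => (G \o U q.1) q.2).
  exact: (measurableT_comp mG mU).
have den x q : 0 <= energy_form_density r (G \o U x) (U x) q.
  rewrite /energy_form_density/= divr_ge0 ?powR_ge0//.
  have [/[dup] h /ndG|/ltW /[dup] h /ndG] := leP (U x q.1) (U x q.2); nra.
have men : measurable_fun [set: R] en by exact: measurable_energy_form.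
have en0 x : (0 <= en x)%E.
  apply: mule_ge0; first by rewrite lee_fin ltW.
  by apply: integral_ge0 => q _; rewrite lee_fin.
have mL x : measurable_fun setT (fun y => (U x y * ln (1 + U x y))%:E).
  have mUx := measurable_slice x mU.
  apply/measurable_EFinP; apply: measurable_funM => //.
  by apply: (measurableT_comp (@measurable_ln R)); exact: measurable_funD.
have L0 x y : 0 <= U x y * ln (1 + U x y) by rewrite mulr_ge0// ln_ge0// lerDl.
have mFU x : measurable_fun setT (fun y => (F (U x y))%:E).
  by apply/measurable_EFinP; apply: (measurableT_comp mF); exact: measurable_slice.
have phi0 x : (0 <= phi x)%E.
  by apply: integral_ge0 => y _; rewrite lee_fin entropy_ge0.
have phiL x : (phi x <= 2%:E * LlogL_integral (U x))%E.
  rewrite -ge0_integralZl_EFin//; last by move=> y _; rewrite lee_fin.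
  apply: ge0_le_integral => //.
  - by move=> y _; rewrite lee_fin entropy_ge0.
  - exact: measurable_funeM.
  - by move=> y _; rewrite -EFinM lee_fin entropy_le.
have phifin x : 0 < x -> phi x \is a fin_num.
  move=> x0; rewrite ge0_fin_numE//; apply: le_lt_trans (phiL x) _.
  by apply: lte_mul_pinfty => //; exact: solution_LlogL.
have ident x : d <= x -> x < t ->
    phi x = (phi t + \int[leb]_(y in `]x, t[) en y)%E.
  move=> dx xt; have x0 := lt_le_trans d0 dx.
  have := Uen t0 (log_cutoff_smooth e01) (log_cutoff_bounded e01) (ltW x0) xt (lexx t).
  rewrite -/f -/G -/(phi t) -/(phi x).
  have := phifin _ t0; have := phifin _ x0.
  rewrite (_ : (\int[leb]_(y in `]x, t[) energy_form r (G \o U y) (U y))%E =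
    (\int[leb]_(y in `]x, t[) en y)%E)//.
  case: (phi x) => // px _; case: (phi t) => // pt _.
  case: (\int[leb]_(y in `]x, t[) en y)%E => // i.
  by rewrite -EFinB -EFinD => -[] H; rewrite -EFinD; congr EFin; lra.
have enfin : (\int[leb]_(y in `]d, t[) en y < +oo)%E.
  have := ident d (lexx d) dt; have := phifin _ t0; have := phifin _ d0.
  case: (phi d) => // px _; case: (phi t) => // pt _.
  by case: (\int[leb]_(y in `]d, t[) en y)%E => // i; rewrite ltry.
have Ben x : d < x < t -> (B x <= 2%:E * en x)%E.
  move=> /andP[dx xt]; rewrite /B /en /energy_form muleCA.
  apply: lee_wpmul2l; first by rewrite lee_fin ltW.
  have m1 := @measurable_energy_form_density_at _ _ _ (measurableTypeR R) r w w x mw mw.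
  have m2 : measurable_fun setT (energy_form_density r (G \o U x) (U x)).
    exact: (@measurable_energy_form_density_at _ _ _ (measurableTypeR R) r
      (fun y => G \o U y) U x mGU mU).
  rewrite -ge0_integralZl_EFin//; last 2 first.
  - by move=> q _; rewrite lee_fin.
  - exact/measurable_EFinP.
  apply: ge0_le_integral => //.
  - by move=> q _; rewrite lee_fin energy_form_density_ge0.
  - exact/measurable_EFinP.
  - by apply: measurable_funeM; exact/measurable_EFinP.
  move=> q _; rewrite -EFinM lee_fin /energy_form_density mulrA.
  rewrite ler_wpM2r ?invr_ge0 ?powR_ge0//.
  have U1 : 0 <= U x q.1 <= K by rewrite U0 UK// ltW.
  have U2 : 0 <= U x q.2 <= K by rewrite U0 UK// ltW.
  have := dissipation_density_ge e01 K1 eK U1 U2.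
  rewrite -/f -/G /w /trunc_above1 expr2 /=; lra.
pose phit := fine (phi t).
have phitE : phi t = phit%:E by rewrite fineK// phifin.
have phit0 : 0 <= phit by rewrite -lee_fin -phitE.
exists phit; split => //.
  rewrite EFinD -phitE EFinM.
  have -> : (M%:E * (ln 4)%:E = \int[mu]_x ((ln 4)%:E * (U t x)%:E))%E.
    rewrite ge0_integralZl_EFin//; last 3 first.
    - by move=> x _; rewrite lee_fin.
    - by apply/measurable_EFinP; exact: measurable_slice.
    - by rewrite ln_ge0// ler1n.
    by rewrite UM muleC.
  rewrite -ge0_integralD//; last 3 first.
  - by move=> x _; rewrite lee_fin entropy_ge0.
  - by move=> x _; rewrite -EFinM lee_fin mulr_ge0// ln_ge0// ler1n.
  - by apply: measurable_funeM; apply/measurable_EFinP; exact: measurable_slice.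
  apply: ge0_le_integral => //.
  - by move=> x _; rewrite lee_fin.
  - apply: emeasurable_funD => //; apply: measurable_funeM.
    by apply/measurable_EFinP; exact: measurable_slice.
  move=> x _; rewrite -EFinM -EFinD lee_fin.
  have Utx : 0 <= U t x <= K by rewrite U0 UK// ltW.
  have eK1 : e * K ^+ 2 <= 1 by apply: le_trans eK _; lra.
  have := entropy_ge e01 Utx eK1; rewrite -/F; lra.
apply: (@time_weighted_energy R d t M a (1 + p) phit phi en B) => //.
- lra.
- by rewrite addr_ge0.
- by move=> x /andP[dx xt]; rewrite -phitE; apply: ident => //; exact: ltW.
move=> x /andP[dx xt].
have sg1 : 0 < x - d <= 1 by rewrite subr_gt0 dx; lra.
have Msg : M * (x - d) <= 1.
  by apply: le_trans Mt; rewrite ler_wpM2l//; lra.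
apply: le_trans (phiL x) _.
apply: le_trans (lee_wpmul2l _ (solution_interpolation x sg1 Msg)) _ => //.
rewrite ge0_muleDr; last 2 first.
- rewrite lee_fin mulr_ge0// addr_ge0// oppr_ge0 mulr_ge0_le0 ?addr_ge0//.
  by apply: ln_le0; case/andP: sg1.
- by apply: mule_ge0 => //; rewrite lee_fin divr_ge0//; case/andP: sg1 => /ltW.
rewrite -EFinM mulrA; apply: leeD => //.
rewrite muleA -EFinM; apply: lee_wpmul2r => //; rewrite lee_fin; lra.
Qed.

(** With d = t / (2 (n + 2)) one has x - d >= x / 2 for x > 2 d, so that the bounds
    of solution_energy_from for these d pass to the limit by monotone convergence
    over the sets ]2 d, t[, at the cost of a factor 2. *)
Lemma solution_smoothing (kappa t : R) : 0 < kappa < 1 -> 0 < t <= kappa ->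
  M * t <= 1 ->
  (LlogL_integral (U t) + (t^-1)%:E * \int[leb]_(x in `]0%R, t[) (x%:E * B x)
   <= (smoothing_const N r kappa * `|ln t| * M)%:E)%E.
Proof.
move=> /andP[k0 k1] /andP[t0 tk] Mt.
have t1 : t < 1 by exact: le_lt_trans k1.
have lk : 0 < - ln kappa by rewrite oppr_gt0 ln_lt0// k0.
have lt : - ln kappa <= - ln t by rewrite lerN2 ler_ln.
have Lfin : LlogL_integral (U t) \is a fin_num.
  rewrite ge0_fin_numE; first exact: solution_LlogL.
  by apply: integral_ge0 => x _; rewrite lee_fin mulr_ge0// ln_ge0// lerDl.
pose L := fine (LlogL_integral (U t)).
have LE : LlogL_integral (U t) = L%:E by rewrite /L fineK.
have L0 : 0 <= L.
  apply: fine_ge0; apply: integral_ge0 => x _.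
  by rewrite lee_fin mulr_ge0// ln_ge0// lerDl.
pose Z := 2 * M * (t * (a + (1 + p) * (4 + ln 2 - ln t))).
pose F (n : nat) : set R := [set` `]t / n.+2%:R, t[].
have mxB (D : set R) : measurable D -> measurable_fun D (fun x => (x%:E * B x)%E).
  move=> mD; apply: measurable_funTS; apply: emeasurable_funM => //.
have n2 (n : nat) : 2 <= n.+2%:R :> R by rewrite ler_nat.
have tn (n : nat) : 0 < t / n.+2%:R <= t / 2.
  by rewrite divr_gt0//= ler_pM2l// lef_pV2 ?posrE.
have bound n : (\int[leb]_(x in F n) (x%:E * B x)
    <= (8 * (Z - t / 2 * (L - M * ln 4)))%:E)%E.
  have [d [d0 d4 dd]] : exists d : R, [/\ 0 < d, 4 * d <= t & t / n.+2%:R = 2 * d].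
    have /andP[tn0 tn2] := tn n; exists (t / n.+2%:R / 2); split.
    - exact: divr_gt0.
    - move: (t / n.+2%:R) tn2 => z; lra.
    - by field.
  have d0t : 0 < d < t by rewrite d0/=; lra.
  rewrite /F dd.
  have [phit [phi0 Lphi]] := solution_energy_from d0t (ltW t1) Mt.
  have : (2^-1%:E * \int[leb]_(x in `](2 * d)%R, t[) (x%:E * B x) <=
      \int[leb]_(x in `]d, t[) ((x - d)%:E * B x))%E.
    have mxd : measurable_fun [set: R] (fun x => ((x - d)%:E * B x)%E).
      apply: emeasurable_funM => //; apply/measurable_EFinP.
      by apply: measurable_funB => //; exact: measurable_cst.
    apply: (@le_trans _ _ (\int[leb]_(x in `](2 * d)%R, t[) ((x - d)%:E * B x))%E).
      rewrite -ge0_integralZl_EFin//; last 2 first.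
      - move=> x; rewrite /= in_itv/= => /andP[tx _].
        by apply: mule_ge0 => //; rewrite lee_fin; lra.
      - by apply: mxB; exact: measurable_itv.
      apply: ge0_le_integral => //.
      - move=> x; rewrite /= in_itv/= => /andP[tx _].
        by rewrite muleA; apply: mule_ge0 => //; rewrite -EFinM lee_fin; lra.
      - by apply: measurable_funeM; apply: mxB; exact: measurable_itv.
      - exact: measurable_funTS.
      - move=> x; rewrite /= in_itv/= => /andP[tx _].
        by rewrite muleA; apply: lee_wpmul2r => //; rewrite -EFinM lee_fin; lra.
    apply: ge0_subset_integral => //.
    - exact: measurable_funTS.
    - move=> x /=; rewrite in_itv/= => /andP[tx _].
      by apply: mule_ge0 => //; rewrite lee_fin; lra.
    - move=> x; rewrite /= !in_itv/= => /andP[tx ->]; rewrite andbT; lra.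
  move: Lphi; rewrite LE lee_fin => Lphi.
  have h2 : t / 2 <= t - d by lra.
  have lnh : - ln (t - d) <= ln 2 - ln t.
    rewrite -(opprB (ln t)) lerN2 -ln_div ?posrE//.
    by rewrite ler_ln ?posrE//; lra.
  have hZ : 2 * M * ((t - d) * (a + (1 + p) * (4 - ln (t - d)))) <= Z.
    have q0 : 0 <= 1 + p by exact: addr_ge0.
    have l0 : 0 <= - ln (t - d) by rewrite oppr_ge0 ln_le0//; lra.
    rewrite /Z; apply: ler_wpM2l; first exact: mulr_ge0.
    apply: ler_pM; [lra| |lra|].
      by rewrite addr_ge0// mulr_ge0//; lra.
    by rewrite lerD2l; apply: ler_wpM2l => //; lra.
  move: (\int[leb]_(x in `](2 * d)%R, t[) _)%E (\int[leb]_(x in _) ((x - d)%:E * B x))%E.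
  move=> I J IJ phiJ.
  have {}phiJ : (((t - d) * phit)%:E + 4^-1%:E * (2^-1%:E * I) <= Z%:E)%E.
    apply: (@le_trans _ _ (((t - d) * phit)%:E + 4^-1%:E * J)%E).
      by apply: leeD => //; apply: lee_wpmul2l.
    by apply: le_trans phiJ _; rewrite lee_fin.
  move: I phiJ {IJ} => [I| |]; last by rewrite leNye.
    rewrite -!EFinM -EFinD !lee_fin => H.
    have : t / 2 * (L - M * ln 4) <= (t - d) * phit.
      apply: (@le_trans _ _ (t / 2 * phit)).
        by apply: ler_wpM2l; lra.
      exact: ler_wpM2r.
    lra.
  have y2 : (2^-1%:E * +oo = +oo :> \bar R)%E by rewrite gt0_muley// lte_fin invr_gt0.
  have y4 : (4^-1%:E * +oo = +oo :> \bar R)%E by rewrite gt0_muley// lte_fin invr_gt0.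
  by rewrite y2 y4 addey// leye_eq => /eqP.
have lim : (\int[leb]_(x in `]0%R, t[) (x%:E * B x)
    <= (8 * (Z - t / 2 * (L - M * ln 4)))%:E)%E.
  have -> : [set` `]0, t[] = \bigcup_n F n.
    apply/seteqP; split => [x /=|x [n _]]; rewrite /F /= !in_itv/=.
      move=> /andP[x0 xt]; exists (Num.truncn (t / x)) => //=; rewrite in_itv/= xt andbT.
      rewrite ltr_pdivrMr// mulrC -ltr_pdivrMr//.
      by apply: lt_trans (truncnS_gt _) _; rewrite ltr_nat.
    move=> /andP[hx ->]; rewrite andbT; apply: lt_trans hx.
    by have /andP[] := tn n.
  have cv : (\int[leb]_(x in F n) (x%:E * B x) @[n --> \oo] -->
      \int[leb]_(x in \bigcup_n F n) (x%:E * B x))%E.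
    apply: ge0_nondecreasing_set_cvg_integral.
    - apply/nondecreasing_seqP => n; rewrite subsetEset => x; rewrite /F /= !in_itv/=.
      move=> /andP[hx ->]; rewrite andbT; apply: le_lt_trans hx.
      by rewrite ler_pM2l// lef_pV2 ?posrE// ler_nat.
    - by move=> n; exact: measurable_itv.
    - by move=> n; apply: mxB; exact: measurable_itv.
    - move=> n x; rewrite /F/= in_itv/= => /andP[hx _]; apply: mule_ge0 => //.
      rewrite lee_fin; apply: ltW; apply: le_lt_trans hx.
      by have /andP[/ltW] := tn n.
  rewrite -(cvg_lim _ cv)//.
  apply: lime_le; first by apply/cvg_ex; eexists; exact: cv.
  exact: nearW.
rewrite LE ler0_norm; last by rewrite ln_le0// ltW.
apply: (@le_trans _ _ (L%:E + (t^-1)%:E * (8 * (Z - t / 2 * (L - M * ln 4)))%:E)%E).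
  by apply: leeD => //; apply: lee_wpmul2l => //; rewrite lee_fin invr_ge0 ltW.
rewrite -EFinM -EFinD lee_fin.
rewrite /smoothing_const; set E := 4 * ln 4 + _ + _.
have ln4 : 0 <= ln 4 :> R by rewrite ln_ge0// ler1n.
have ln20 : 0 <= ln 2 :> R by rewrite ln_ge0// ler1n.
have E0 : 0 <= E.
  by rewrite /E !addr_ge0 ?mulr_ge0 ?addr_ge0.
have EE : E <= E / (- ln kappa) * (- ln t).
  by rewrite mulrAC ler_pdivlMr// ler_wpM2l.
have ZE : L + t^-1 * (8 * (Z - t / 2 * (L - M * ln 4))) =
    - 3 * L + M * (E + 16 * (1 + p) * - ln t).
  by rewrite /Z /E; field; rewrite gt_eqF.
rewrite ZE.
apply: (@le_trans _ _ (M * (E + 16 * (1 + p) * - ln t))).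
  by rewrite gerDr mulNr oppr_le0 mulr_ge0.
rewrite [leRHS]mulrC; apply: ler_wpM2l => //.
by rewrite [leRHS]mulrDl lerD2r.
Qed.

End solution.
End smoothing.

Theorem lemma4p1 (R : realType) (N : nat) (s r : R) (hN : (1 <= N)%N)
    (hs : 0 < s < 1) (hs1 : N = 1%N -> s < 1 / 2) (hr : r = 1 - s) :
  exists C theta : R, 0 < C /\ 0 < theta /\
  forall kappa : R, 0 < kappa < 1 ->
  exists2 C0 : R, 0 < C0 &
  forall (u : R -> 'rV[R]_N -> R) (u0 : 'rV[R]_N -> R),
    (forall t x, 0 <= t -> 0 <= u t x) ->
    (forall x, 0 <= u0 x) ->
    (@lebesgue_rV R N).-integrable setT (EFin \o u0) ->
    (forall T : R, 0 < T -> weak_energy_solution s T u u0) ->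
    constructed_solution u u0 ->
    (forall t : R, 0 < t -> LlogL (u t)) /\
    (forall t : R, 0 < t <= time_bound kappa C theta (L1norm u0) ->
      (LlogL_integral (u t)
       + (t^-1)%:E * \int[@lebesgue_measure R]_(tau in `]0%R, t[)
           (tau%:E * energy_form r (trunc_above1 (u tau)) (trunc_above1 (u tau)))
       <= (C0 * `|ln t| * L1norm u0)%:E)%E).
Proof.
have c0 : 0 < energy_form_const N r by rewrite hr; exact: energy_form_const_gt0.
have r0 : 0 < r by rewrite hr subr_gt0; case/andP: hs.
exists 1, 1; split => //; split => // kappa k01.
exists (smoothing_const N r kappa); first exact: smoothing_const_gt0.
move=> u u0 upos u0pos iu0 usol ucon.
pose M := L1norm u0.
pose U (t : R) := u (Num.max t 0).
have Uu t : 0 <= t -> U t = u t by move=> t0; rewrite /U; congr u; exact/max_idPl.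
have m0 t : 0 <= Num.max t 0 :> R by rewrite le_max lexx orbT.
have U0 t x : 0 <= U t x by exact: upos.
have UM t : (\int[@lebesgue_rV R N]_x (U t x)%:E = M%:E)%E.
  rewrite (mass_solution ucon)// /M /L1norm /Rintegral.
  under [in RHS]eq_integral do rewrite ger0_norm//.
  by rewrite fineK//; exact: integrable_fin_num.
have mU : measurable_fun [set: measurableTypeR R * 'rV[R]_N] (fun q => U q.1 q.2).
  apply: (measurable_comp _ _ (measurable_solution ucon)
    (g := fun q : measurableTypeR R * 'rV[R]_N => (Num.max q.1 0, q.2))).
  - by apply: measurableX => //; exact: measurable_itv.
  - by move=> _ [q _ <-]; split => //=; rewrite in_itv/= m0.
  - apply: measurable_fun_pair; last exact: measurable_snd.
    by apply: measurable_maxr; [exact: measurable_fst|exact: measurable_cst].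
have Ubd d : 0 < d -> exists K : R, forall t x, d <= t -> U t x <= K.
  move=> d0; have [K uK] := bounded_solution ucon d0; exists K => t x dt.
  by rewrite Uu ?uK// (le_trans (ltW d0)).
have Uen T : 0 < T -> energy_identity r T U.
  move=> T0 f sf bf F G t1 t2 t10 t12 t2T.
  have [_ _] := usol _ T0; rewrite -hr => /(_ f sf bf t1 t2 t10 t12 t2T).
  rewrite (Uu t1 t10) (Uu t2 (le_trans t10 (ltW t12))).
  move=> <-; congr (_ + _)%E; apply: eq_integral => t.
  rewrite inE/= in_itv/= => /andP[t1t _].
  by rewrite Uu// (le_trans t10)// ltW.
split=> [t t0|t /andP[t0 tb]].
  by rewrite -Uu ?ltW//; exact: (solution_LlogL mU U0 UM Ubd).
(* With C = theta = 1 the bound on t includes M * t <= 1, also when M = 0. *)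
have [tk Mt] : t <= kappa /\ M * t <= 1.
  move: tb; rewrite /time_bound -/M; case: ifPn => [/eqP ->|M0].
    by rewrite mul0r.
  have M_ge0 : 0 <= M by exact: Rintegral_ge0.
  rewrite le_min => /andP[-> ]; rewrite mul1r powR_inv1// => tM; split => //.
  by rewrite mulrC -ler_pdivlMr ?mul1r// lt_neqAle eq_sym M0.
have t0k : 0 < t <= kappa by rewrite t0.
have smoothing := solution_smoothing hN r0 c0 mU U0 UM Ubd Uen k01 t0k Mt.
have Uint : (\int[@lebesgue_measure R]_(tau in `]0%R, t[)
      (tau%:E * energy_form r (trunc_above1 (U tau)) (trunc_above1 (U tau))) =
    \int[@lebesgue_measure R]_(tau in `]0%R, t[)
      (tau%:E * energy_form r (trunc_above1 (u tau)) (trunc_above1 (u tau))))%E.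
  apply: eq_integral => tau; rewrite inE/= in_itv/= => /andP[tau0 _].
  by rewrite (Uu tau (ltW tau0)).
by rewrite Uint (Uu t (ltW t0)) in smoothing.
Qed.
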